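(* Let $f\colon \mathbf P^k\dashrightarrow\mathbf P^m$ be a rational map defined by $m+1$ polynomials $(f_0,\dots,f_m)$ in $k+1$ variables with coefficients in $\overline{\mathbf Q}$, homogeneous of the same degree $d$ and without common factor. Let $Z\subset\mathbf P^k$ be the locus of common zeros of $f_0,\dots,f_m$. Then: (a) There exists a real number $c_1$ such that $h(f(x))\le d\,h(x)+c_1$ for every $x\in(\mathbf P^k\setminus Z)(\overline{\mathbf Q})$. (b) For every closed subvariety $X$ of $\mathbf P^k$ that does not meet $Z$, there exists a real number $c_X$ such that $h(f(x))\ge d\,h(x)-c_X$ for every $x\in X(\overline{\mathbf Q})$.
   Context: $h$ denotes the absolute logarithmic Weil height on projective space over $\overline{\mathbf Q}$: if $x=[x_0:\cdots:x_k]$ with coordinates in a number field $K$, then $$h(x)=\frac1{[K:\mathbf Q]}\sum_{p\le\infty}\ \sum_{\sigma\colon K\hookrightarrow\mathbf C_p}\log\max(|\sigma(x_0)|_p,\dots,|\sigma(x_k)|_p),$$ where $p$ runs over the prime numbers and the symbol $\infty$, $\mathbf C_\infty=\mathbf C$, and $\mathbf C_p$ (for $p$ prime) is the completion of an algebraic closure of $\mathbf Q_p$, with its absolute value extending the standard $p$-adic one ($|p|_p=1/p$). Subvarieties are defined over $\overline{\mathbf Q}$. *)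

(* Defs.v *)
(* The notations of mpoly clash with those of MathComp-Analysis, and some of its
   names with those of the files below: hence the form and place of its import. *)
From mathcomp Require Import -(notations) mpoly.
From mathcomp Require Import all_boot all_order all_algebra all_field.
From mathcomp Require Import generic_quotient complex.
From mathcomp Require Import all_classical all_reals all_analysis.
Set Implicit Arguments.
Unset Strict Implicit.
Unset Printing Implicit Defensive.
Import Order.TTheory GRing.Theory Num.Theory.
Local Open Scope classical_set_scope.
Local Open Scope quotient_scope.
Local Open Scope ring_scope.

Definition absolute_value (R : realType) (K : fieldType) (abs : K -> R) : Prop :=
  [/\ forall x, 0 <= abs x,
      forall x, abs x = 0 <-> x = 0,
      forall x y, abs (x * y) = abs x * abs y
    & forall x y, abs (x + y) <= abs x + abs y].

Definition abs_complete (R : realType) (K : fieldType) (abs : K -> R) : Prop :=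
  forall u : nat -> K,
    (forall e, 0 < e -> exists N, forall m n,
        (N <= m)%N -> (N <= n)%N -> abs (u m - u n) < e) ->
    exists l, forall e, 0 < e -> exists N, forall n, (N <= n)%N ->
        abs (u n - l) < e.

Definition is_completion (R : realType) (K L : fieldType)
    (absK : K -> R) (absL : L -> R) (i : {rmorphism K -> L}) : Prop :=
  [/\ absolute_value absL,
      forall x, absL (i x) = absK x,
      forall y e, 0 < e -> exists x, absL (y - i x) < e
    & abs_complete absL].

Definition is_algebraic_closure (K L : fieldType) (i : {rmorphism K -> L}) :
    Prop :=
  GRing.closed_field_axiom L /\ forall y, algebraicOver i y.

Definition padic_abs (R : realType) (p : nat) (q : rat) : R :=
  if q == 0 then 0
  else p%:R ^+ logn p `|denq q|%N / p%:R ^+ logn p `|numq q|%N.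

(* C_p is only determined up to isometric isomorphism; a value of this type is
   one way of carrying out the construction Q -> Q_p -> Q_p^alg -> C_p.  It is
   meant for p prime only. *)
Record padic_complex (R : realType) (p : nat) := PadicComplex {
  pc_Qp : fieldType;
  pc_Qp_abs : pc_Qp -> R;
  pc_of_rat : {rmorphism rat -> pc_Qp};
  pc_Qp_completion : is_completion (@padic_abs R p) pc_Qp_abs pc_of_rat;
  pc_Qpalg : fieldType;
  pc_Qpalg_abs : pc_Qpalg -> R;
  pc_of_Qp : {rmorphism pc_Qp -> pc_Qpalg};
  pc_Qpalg_closure : is_algebraic_closure pc_of_Qp;
  pc_Qpalg_absolute_value : absolute_value pc_Qpalg_abs;
  pc_Qpalg_abs_extends : forall x, pc_Qpalg_abs (pc_of_Qp x) = pc_Qp_abs x;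
  pc_field :> fieldType;
  pc_abs : pc_field -> R;
  pc_of_Qpalg : {rmorphism pc_Qpalg -> pc_field};
  pc_completion : is_completion pc_Qpalg_abs pc_abs pc_of_Qpalg
}.

Definition prime_number := {p : nat | prime p}.

Section ProjectiveSpace.
Variables (F : fieldType) (n : nat).

Definition nzvec := {v : 'rV[F]_n.+1 | v != 0}.

Definition collinear (u v : nzvec) : bool :=
  `[< exists c : F, c != 0 /\ val v = c *: val u >].

Lemma collinear_refl : reflexive collinear.
Proof. by move=> u; apply/asboolP; exists 1; rewrite oner_neq0 scale1r. Qed.

Lemma collinear_sym : symmetric collinear.
Proof.
suff h u v : collinear u v -> collinear v u by move=> u v; apply/idP/idP; exact: h.
move=> /asboolP[c [c0 vE]]; apply/asboolP; exists c^-1; split.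
  by rewrite invr_eq0.
by rewrite [X in _ *: X]vE scalerA mulVf // scale1r.
Qed.

Lemma collinear_trans : transitive collinear.
Proof.
move=> v u w /asboolP[c [c0 vE]] /asboolP[b [b0 wE]]; apply/asboolP.
by exists (b * c); split; [exact: mulf_neq0 | rewrite [LHS]wE vE scalerA].
Qed.

Canonical collinear_equiv :=
  EquivRel collinear collinear_refl collinear_sym collinear_trans.

Definition proj_space := {eq_quot collinear_equiv}.

Definition proj_point (v : 'rV[F]_n.+1) (v0 : v != 0) : proj_space :=
  \pi_proj_space (exist _ v v0 : nzvec).

Definition coords (x : proj_space) : 'rV[F]_n.+1 := val (repr x).

End ProjectiveSpace.

Definition embeddings (K C : fieldType) : set (K -> C) :=
  [set s | zmod_morphism s /\ monoid_morphism s].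

(* The embeddings are finitely many, so the finitely supported sum below, which
   is 0 by convention on infinite supports, is the genuine one; the same holds
   for the sum over primes in [height_in].  The value 0 from which the maximum
   starts is harmless, abs being nonnegative. *)
Definition local_height (R : realType) (K C : fieldType) (abs : C -> R)
    (n : nat) (y : 'I_n -> K) : R :=
  \sum_(s \in @embeddings K C) ln (\big[Num.max/0]_(i < n) abs (s (y i))).

Definition height_in (R : realType)
    (Cp : forall p : prime_number, padic_complex R (val p))
    (K : fieldExtType rat) (n : nat) (y : 'I_n -> K) : R :=
  (\dim {:K})%:R^-1 *
  (\sum_(p \in [set: prime_number]) local_height (@pc_abs R _ (Cp p)) y
   + local_height (fun z : R[i] => ComplexField.Normc.normc z) y).

(* [num_field_exists s] provides a number field K, an embedding of K in algC and
   elements t of K mapped to the algebraic numbers listed in s.  The height does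
   not depend on the choice of K, nor on that of homogeneous coordinates. *)
Definition height (R : realType)
    (Cp : forall p : prime_number, padic_complex R (val p))
    (n : nat) (x : proj_space algC n) : R :=
  let: existT K (existT _ (exist2 t _ _)) :=
    num_field_exists [seq coords x 0 i | i <- enum 'I_n.+1] in
  height_in Cp (fun i : 'I_n.+1 => t`_i : K).

Definition homogeneous (n d : nat) (g : mpoly n algC) : Prop :=
  g \is ishomog1 d (@mdeg n).

(* Independent of the choice of coordinates when g is homogeneous. *)
Definition vanishes_at (n : nat) (g : mpoly n.+1 algC)
    (x : proj_space algC n) : Prop :=
  meval (coords x 0) g = 0.

Definition zero_locus (n : nat) (S : set (mpoly n.+1 algC)) :
    set (proj_space algC n) :=
  [set x | forall g, S g -> vanishes_at g x].

(* A subvariety over algC is identified with its set of points over algC; it is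
   not required to be irreducible. *)
Definition closed_subvariety (n : nat) (X : set (proj_space algC n)) : Prop :=
  exists S : set (mpoly n.+1 algC),
    (forall g, S g -> exists d, homogeneous d g) /\ X = zero_locus S.

(* The units of a polynomial ring over a field are the nonzero constants; this
   condition excludes the case where all the f i vanish. *)
Definition no_common_factor (n m : nat) (f : 'I_m -> mpoly n algC) :
    Prop :=
  forall g, (forall i, exists q, f i = q * g) -> g \is a GRing.unit.

Section RationalMap.
Variables (k m : nat) (f : 'I_m.+1 -> mpoly k.+1 algC).

Definition indeterminacy : set (proj_space algC k) := zero_locus (range f).

Definition ratmap_coords (x : proj_space algC k) : 'rV[algC]_m.+1 :=
  \row_i meval (coords x 0) (f i).

Lemma ratmap_coords_neq0 x : ~ indeterminacy x -> ratmap_coords x != 0.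
Proof.
apply: contra_notN => /eqP fx0 _ [i _ <-].
by have /rowP/(_ i) := fx0; rewrite !mxE.
Qed.

Definition ratmap (x : proj_space algC k) (hx : ~ indeterminacy x) :
    proj_space algC m :=
  proj_point (ratmap_coords_neq0 hx).

End RationalMap.

(* Main.v *)
(** For a point x with coordinates in a Galois number field N, the embeddings of
    N in C_p are the composites of one of them with the automorphisms of N.
    Hence heights do not depend on the field of definition, and they do not
    depend on the homogeneous coordinates: the norm of the scaling factor is
    rational, where the product formula is the factorization of integers.

    Each absolute value of N satisfies |f_i(x)| <= C |x|^d, with C a maximum of
    absolute values of coefficients times, at the infinite places, a number of
    terms; summing the logarithms over all places gives the upper bound.

    For the lower bound, let S be homogeneous equations of X.  As S and the f_i
    have no common zero in projective space, the Nullstellensatz provides forms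
    G_ji of some degree e with x_j^(e+d) = sum_i G_ji(x) f_i(x) on X, whence
    |x|^(e+d) <= C |x|^e |f(x)| at each place. *)
From HB Require Import structures.
From mathcomp Require Import -(notations) mpoly.
Require Import Defs.
From mathcomp Require Import all_boot all_order all_fingroup all_algebra all_field.
From mathcomp Require Import generic_quotient complex.
From mathcomp Require Import all_classical all_reals all_analysis.
From mathcomp Require Import ring lra.
Set Implicit Arguments.
Unset Strict Implicit.
Unset Printing Implicit Defensive.
Import Order.TTheory GRing.Theory Num.Theory.
Local Open Scope classical_set_scope.
Local Open Scope ring_scope.

(** * The Nullstellensatz *)

(** A root x of p X + 1 satisfies p(x) x = -1, so p(x) cannot vanish. *)
Lemma closed_field_nonroot (F : closedFieldType) (p : {poly F}) :
  p != 0 -> exists x, p.[x] != 0.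
Proof.
move=> p0.
have szq : size (p * 'X + 1) = (size p).+1.
  by rewrite size_MXaddC (negPf p0).
have /closed_rootP[x] : size (p * 'X + 1) != 1 by rewrite szq eqSS size_poly_eq0.
rewrite /root !hornerE => px; exists x; apply: contraTneq px => ->.
by rewrite mul0r add0r oner_neq0.
Qed.

Lemma mpoly_rmorph_ext (n : nat) (R S : comNzRingType)
    (phi psi : {rmorphism mpoly n R -> S}) :
    (forall c, phi (mpolyC n c) = psi (mpolyC n c)) ->
    (forall i, phi (mpolyX R (mnm1 i)) = psi (mpolyX R (mnm1 i))) ->
  phi =1 psi.
Proof.
move=> eqC eqX p; rewrite [p]mpolyE !rmorph_sum; apply: eq_bigr => m _.
rewrite -mul_mpolyC !rmorphM /= eqC mpolyXE_id !rmorph_prod; congr (_ * _).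
by apply: eq_bigr => i _; rewrite !rmorphXn /= eqX.
Qed.

(* The substitution X_i := X_i + l_i T for i < n, X_n := l_n T.  It makes the
   coefficient of the highest power of T in p the value at l of the top-degree
   form of p, so that p becomes monic in T up to a constant when that value is
   not 0. *)
Section LinearChange.

Variables (n : nat) (F : fieldType) (l : 'I_n.+1 -> F).
Hypothesis l_max : l ord_max != 0.

Local Notation A := (mpoly n F).
Local Notation B := (mpoly n.+1 F).

Definition change_var (i : 'I_n.+1) : {poly A} :=
  oapp (fun j => (mpolyX F (mnm1 j))%:P) 0 (unlift ord_max i)
  + (mpolyC n (l i))%:P * 'X.

Definition change : {rmorphism B -> {poly A}} :=
  mmap (polyC \o @mpolyC n F) change_var.

Definition unchange_coef : {rmorphism A -> B} :=
  mmap (@mpolyC n.+1 F)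
    (fun j => mpolyX F (mnm1 (lift ord_max j))
       - mpolyC _ (l (lift ord_max j) / l ord_max) * mpolyX F (mnm1 ord_max)).

Definition unchange : {rmorphism {poly A} -> B} :=
  horner_eval (mpolyC _ (l ord_max)^-1 * mpolyX F (mnm1 ord_max))
  \o map_poly unchange_coef.

Lemma changeX i : change (mpolyX F (mnm1 i)) = change_var i.
Proof. by rewrite /change /= mmapX mmap1U. Qed.

Lemma changeC c : change (mpolyC _ c) = (mpolyC _ c)%:P.
Proof. by rewrite /change /= mmapC. Qed.

(** Both sides are ring morphisms in [p], so constants and variables suffice. Hence [change] is
    injective and sends an ideal of [B] into its preimage under [unchange]. *)
Lemma unchangeK (p : B) : unchange (change p) = p.
Proof.
have -> : p = [the {rmorphism B -> B} of idfun] p by [].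
rewrite -[LHS]/([the {rmorphism B -> B} of unchange \o change] p).
apply: mpoly_rmorph_ext => [c|i] /=.
  by rewrite changeC map_polyC /horner_eval hornerC /= mmapC.
rewrite changeX /change_var /horner_eval rmorphD rmorphM /= map_polyX !hornerE.
rewrite !map_polyC /= !hornerE /= mmapC.
case: unliftP => [j ->|->] /=; last first.
  by rewrite rmorph0 horner0 add0r -rmorphM mulfV // rmorph1 mul1r.
rewrite map_polyC hornerC /= mmapX mmap1U.
by rewrite -rmorphM subrK.
Qed.

Definition change_point (a : 'I_n -> F) (s : F) (i : 'I_n.+1) : F :=
  oapp a 0 (unlift ord_max i) + l i * s.

Lemma horner_change (a : 'I_n -> F) s p :
  (map_poly (meval a) (change p)).[s] = meval (change_point a s) p.
Proof.
rewrite -[LHS]/([the {rmorphism B -> F} of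
   horner_eval s \o map_poly (meval a) \o change] p).
apply: mpoly_rmorph_ext => [c|i] /=.
  by rewrite changeC map_polyC /horner_eval hornerC /= !mevalC.
rewrite changeX /change_var /horner_eval rmorphD rmorphM /= map_polyX !hornerE.
rewrite map_polyC /= hornerC mevalC mevalXU /change_point; congr (_ + _).
case: (unlift ord_max i) => [j|] /=; last by rewrite rmorph0 horner0.
by rewrite map_polyC hornerC /= mevalXU.
Qed.

(** The size is only bounded and [c] may be 0; this keeps the predicate multiplicative and lets
    monomials of lower degree be added. *)
Definition top_coef (d : nat) (q : {poly A}) (c : F) :=
  (size q <= d.+1)%N /\ q`_d = mpolyC n c.

Lemma top_coefM d e p q b c :
  top_coef d p b -> top_coef e q c -> top_coef (d + e) (p * q) (b * c).
Proof.
move=> [sp pE] [sq qE]; split.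
  apply: leq_trans (size_polyMleq _ _) _.
  by rewrite -subn1 leq_subLR add1n -addSn -addnS leq_add.
(* Only the term of index [d] survives: before it the index in [q] exceeds [e], after it the index
   in [p] exceeds [d]. *)
rewrite coefM (bigD1 (inord d)) //= inordK ?ltnS ?leq_addr //.
rewrite addKn pE qE rmorphM big1 ?addr0 // => i ni.
have {}ni : (i : nat) != d.
  by apply: contraNneq ni => id; apply/eqP/val_inj; rewrite /= inordK // ltnS leq_addr.
case: (ltngtP i d) ni => // [ltid|ltdi] _.
  rewrite [q`__]nth_default ?mulr0 //; apply: leq_trans sq _.
  by rewrite ltn_subRL ltn_add2r.
by rewrite nth_default ?mul0r //; apply: leq_trans sp _.
Qed.

Lemma top_coefX d p c k : top_coef d p c -> top_coef (d * k) (p ^+ k) (c ^+ k).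
Proof.
move=> h; elim: k => [|k IH]; last by rewrite mulnS !exprS; exact: top_coefM.
by rewrite muln0 !expr0; split; rewrite ?size_poly1 // coef1 rmorph1.
Qed.

Lemma top_coef_change_mnm (m : multinom n.+1) :
  top_coef (mdeg m) (change (mpolyX F m)) (\prod_i l i ^+ m i).
Proof.
rewrite mdegE mpolyXE_id rmorph_prod /=.
elim/big_rec3: _ => [|i d q c _ h]; first by split; rewrite ?size_poly1 // coef1 rmorph1.
apply: top_coefM h; rewrite rmorphXn /= changeX -[X in top_coef X]mul1n.
apply: top_coefX; split.
  apply: leq_trans (size_polyD _ _) _; rewrite geq_max; apply/andP; split.
    case: (unlift _ _) => [j|] /=; last by rewrite size_poly0.
    by apply: leq_trans (size_polyC_leq1 _) _.
  apply: leq_trans (size_polyMleq _ _) _; rewrite size_polyX addn2 /=.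
  exact: size_polyC_leq1.
rewrite coefD coefMX coefC /=; case: (unlift _ _) => [j|] /=.
  by rewrite coefC add0r.
by rewrite coef0 add0r.
Qed.

Definition top_form (p : B) : B :=
  \sum_(m <- msupp p | mdeg m == (msize p).-1) mcoeff m p *: mpolyX F m.

Lemma top_coef_change (p : B) :
  top_coef (msize p).-1 (change p) (meval l (top_form p)).
Proof.
rewrite {2}[p]mpolyE /top_form !rmorph_sum /=.
rewrite [X in top_coef _ _ X]big_mkcond /= !big_seq.
elim/big_rec2: _ => [|m c q mp [sq qE]].
  by split; rewrite ?size_poly0 // coef0 rmorph0.
have [sm mE] := top_coef_change_mnm m.
have mlt : (mdeg m <= (msize p).-1)%N.
  by rewrite -ltnS; apply: leq_trans (leqSpred _); exact: msize_mdeg_lt.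
rewrite -mul_mpolyC rmorphM /= changeC mul_polyC; split.
  apply: leq_trans (size_polyD _ _) _; rewrite geq_max sq andbT.
  apply: leq_trans (size_scale_leq _ _) _; apply: leq_trans sm _.
  by rewrite ltnS.
rewrite coefD qE coefZ; case: eqP => [mdE|/eqP mdN].
  rewrite -mdE mE mevalM mevalC mevalX.
  by rewrite [LHS]addrC rmorphD rmorphM [RHS]addrC.
rewrite nth_default ?mulr0 ?add0r //; apply: leq_trans sm _.
by rewrite ltn_neqAle mdN.
Qed.

Lemma top_form_neq0 (p : B) : p != 0 -> top_form p != 0.
Proof.
move=> p0; apply/eqP => /(congr1 (mcoeff (mlead p))).
rewrite /top_form mcoeff0 raddf_sum /= big_mkcond.
rewrite (bigD1_seq (mlead p)) ?mlead_supp ?msupp_uniq //=.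
rewrite -mlead_deg // eqxx mcoeffZ mcoeffX eqxx mulr1 big1 ?addr0.
  by apply/eqP; rewrite mleadc_eq0.
move=> m mN; case: ifP => // _.
by rewrite mcoeffZ mcoeffX (negPf mN) mulr0.
Qed.

End LinearChange.

Lemma mpoly0E (R : nzRingType) (p : mpoly 0 R) : p = mpolyC 0 (mcoeff mnm0 p).
Proof.
apply/mpolyP => m; have -> : m = mnm0 by apply/mnmP => -[].
by rewrite mcoeffC eqxx mulr1.
Qed.

(** Induction on the number of variables: choose a point where the leading coefficient in the last
    variable does not vanish, then a value of that variable that is not a root. *)
Lemma mpoly_nonvanishing (F : closedFieldType) (n : nat) (p : mpoly n F) :
  p != 0 -> exists v : 'I_n -> F, meval v p != 0.
Proof.
elim: n p => [|n IH] p p0.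
  by exists (fun=> 0); move: p0; rewrite [p]mpoly0E mevalC mpolyC_eq0.
(* With this [l] the substitution merely renames the last variable as T. *)
pose l (i : 'I_n.+1) : F := (i == ord_max)%:R.
have l1 : l ord_max != 0 by rewrite /l eqxx oner_neq0.
have q0 : change l p != 0.
  by apply: contra_neq p0 => q0; rewrite -[p](unchangeK l1) q0 rmorph0.
have [a a0] := IH _ (etrans (congr1 negb (lead_coef_eq0 _)) q0).
have qa0 : map_poly (meval a) (change l p) != 0.
  by apply: contraNneq a0 => qa; rewrite lead_coefE -coef_map qa coef0.
have [s sq] := closed_field_nonroot qa0.
by exists (change_point l a s); rewrite -horner_change.
Qed.

Definition ideal_pred (A : comNzRingType) (I : A -> Prop) : Prop :=
  [/\ I 0, forall x y, I x -> I y -> I (x + y) & forall a x, I x -> I (a * x)].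

Lemma ideal_pred_sum (A : comNzRingType) (I : A -> Prop) (T : finType)
    (f : T -> A) :
  ideal_pred I -> (forall i, I (f i)) -> I (\sum_i f i).
Proof. by case=> I0 ID _ If; elim/big_ind: _. Qed.

(** Euclidean division, by induction on the size, leads to a nonzero element of [J] dividing all the
    others. It is not constant, since 1 is not in [J], and its roots are common zeros. *)
Lemma poly_ideal_root (F : closedFieldType) (J : {poly F} -> Prop) :
    ideal_pred J -> ~ J 1 -> (exists2 g, J g & g != 0) ->
  exists s, forall q, J q -> q.[s] = 0.
Proof.
move=> [J0 JD JM] J1 [g].
have [N] := ubnP (size g); elim: N g => // N IH w szw Jw w0.
have [wdiv|] := pselect (forall q, J q -> w %| q).
  have /closed_rootP[s ws] : size w != 1.
    apply/negP => /size_poly1P[c c0 wE]; apply: J1.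
    have -> : 1 = c^-1%:P * w by rewrite wE -polyCM mulVf.
    exact: JM.
  exists s => q /wdiv/dvdpP[u ->].
  by rewrite hornerM (eqP ws) mulr0.
move=> /existsNP[q /not_implyP[Jq /negP wq]].
apply: (IH (q %% w)); last by [].
- by rewrite -ltnS; apply: leq_trans szw; rewrite ltnS ltn_modpN0.
- have -> : q %% w = q + (- (q %/ w)) * w.
    by rewrite {2}(divp_eq q w) addrC mulNr addKr.
  by apply: JD => //; exact: JM.
Qed.

(* The multiplication by p on the free module A[t]/(g) has a matrix whose
   determinant lies in the ideal generated by p and g, by Cramer's rule. *)
Lemma monic_ideal_fibre_proper (A : comNzRingType) (F : fieldType)
    (I : {poly A} -> Prop) (g : {poly A}) (ev : {rmorphism A -> F}) :
    ideal_pred I -> ~ I 1 -> I g -> g \is monic ->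
    (forall c, I c%:P -> ev c = 0) ->
  forall p, I p -> map_poly ev p <> 1.
Proof.
move=> idI I1 Ig gm evI p Ip evp; have [I0 ID IM] := idI.
have [g1|] := leqP (size g) 1.
  apply: I1; have gE := size1_polyC g1.
  have g01 : g`_0 = 1 by rewrite -(monicP gm) [X in lead_coef X]gE lead_coefC.
  by rewrite -polyC1 -g01 -gE.
case Dg: (size g) => [|[|D]] // _.
pose r (i : 'I_D.+1) := Pdiv.Ring.rmodp ('X^i * p) g.
have rE i := Pdiv.RingMonic.rdivp_eq gm ('X^i * p).
have Ir i : I (r i).
  have -> : r i = 'X^i * p + (- Pdiv.Ring.rdivp ('X^i * p) g) * g.
    by rewrite [X in X + _]rE mulNr addrC addKr.
  by apply: ID; exact: IM.
have szr i : (size (r i) <= D.+1)%N.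
  by rewrite -ltnS -Dg Pdiv.Ring.ltn_rmodpN0 // monic_neq0.
pose M : 'M[A]_D.+1 := \matrix_(i, j) (r i)`_j.
have sumM i : \sum_j (M i j)%:P * 'X^j = r i.
  rewrite -[RHS](coefK (r i)); apply/polyP => k.
  rewrite coef_sum coef_poly; have [kD|Dk] := ltnP k D.+1; last first.
    rewrite ltnNge (leq_trans (szr i) Dk) /= big1 // => j _.
    by rewrite coefCM coefXn gtn_eqF ?mulr0 //; apply: leq_trans Dk.
  rewrite (bigD1 (Ordinal kD)) //= big1 ?addr0 => [|j jk].
    rewrite coefCM coefXn eqxx mulr1 mxE /=.
    by case: ltnP => // rk; rewrite nth_default.
  by rewrite coefCM coefXn eq_sym (_ : (j == k :> nat) = false) ?mulr0 //; apply/negbTE.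
(* Combining the relations sum_j M_ij t^j = r_i with row 0 of the adjugate leaves det M times
   t^0. *)
have IdetM : I (\det M)%:P.
  have -> : (\det M)%:P = \sum_i (\adj M ord0 i)%:P * r i.
    under eq_bigr do rewrite -sumM mulr_sumr.
    rewrite exchange_big /= (bigD1 ord0) //= [X in _ + X]big1 => [|j j0].
      rewrite addr0 expr0; under eq_bigr do rewrite mulr1 -polyCM.
      rewrite -rmorph_sum /=; have /matrixP/(_ ord0 ord0) := mul_adj_mx M.
      by rewrite !mxE eqxx mulr1n => ->.
    under eq_bigr do rewrite mulrA -polyCM.
    rewrite -mulr_suml -rmorph_sum /=.
    have /matrixP/(_ ord0 j) := mul_adj_mx M.
    by rewrite !mxE eq_sym (negPf j0) mulr0n => ->; rewrite polyC0 mul0r.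
  by apply: ideal_pred_sum => // i; exact: IM.
have gm' : map_poly ev g \is monic by exact: monic_map.
have Dg' : size (map_poly ev g) = D.+2.
  by rewrite size_map_poly_id0 // (monicP gm) rmorph1 oner_neq0.
(* The image of [p] is 1, so [M] specializes to the identity matrix and its determinant to 1,
   whereas [evI] makes it 0. *)
have rE' i : map_poly ev (r i) = 'X^i.
  have := congr1 (map_poly ev) (rE i).
  rewrite !(rmorphM, rmorphD) /= evp mulr1 map_polyXn => /esym E.
  rewrite -[LHS](modp_small (p := map_poly ev (r i)) (q := map_poly ev g)); last first.
    by rewrite Dg' ltnS; apply: leq_trans (size_poly _ _) _.
  rewrite -[RHS](modp_small (p := 'X^i) (q := map_poly ev g)); last first.
    by rewrite Dg' size_polyXn ltnS.
  by rewrite -E modpD modp_mull add0r.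
have : ev (\det M) = 1.
  rewrite -det_map_mx; have -> : map_mx ev M = 1%:M; last exact: det1.
  apply/matrixP => i j; rewrite !mxE -coef_map rE' coefXn eq_sym.
  by rewrite -val_eqE.
by rewrite evI // => /eqP; rewrite eq_sym oner_eq0.
Qed.

(** Induction on [n]. A nonzero element of [I] becomes monic in T after a linear change of
    variables. The constants in T lying in the ideal have a common zero [a] by induction; the fibre
    over [a] is a proper ideal of F[T], hence has a root. *)
Theorem weak_nullstellensatz (F : closedFieldType) (n : nat)
    (I : mpoly n F -> Prop) :
  ideal_pred I -> ~ I 1 -> exists v : 'I_n -> F, forall p, I p -> meval v p = 0.
Proof.
elim: n I => [|n IH] I idI I1; have [I0 ID IM] := idI.
  exists (fun=> 0) => p; rewrite [p]mpoly0E mevalC; move: (mcoeff _ _) => c Ic.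
  apply/eqP/negP => /negP c0; apply: I1.
  have -> : 1 = mpolyC 0 c^-1 * mpolyC 0 c by rewrite -rmorphM mulVf // rmorph1.
  exact: IM.
have [[g Ig g0]|noI] := pselect (exists2 g, I g & g != 0); last first.
  exists (fun=> 0) => p Ip; have [->|p0] := eqVneq p 0; first by rewrite meval0.
  by case: noI; exists p.
(* The extra factor X_n forces the last entry of [l] to be nonzero, as the inversion of the
   substitution requires. *)
have [l lg] : exists l : 'I_n.+1 -> F,
    meval l (top_form g * mpolyX F (mnm1 ord_max)) != 0.
  apply: mpoly_nonvanishing; rewrite mulf_neq0 ?top_form_neq0 //.
  apply/eqP => /(congr1 (mcoeff (mnm1 ord_max))).
  by rewrite mcoeffX mcoeff0 eqxx => /eqP; rewrite oner_eq0.
move: lg; rewrite mevalM mulf_eq0 mevalXU negb_or => /andP[lg l0].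
pose I' (q : {poly mpoly n F}) := I (unchange l q).
have idI' : ideal_pred I'.
  split; rewrite /I'; first by rewrite rmorph0.
    by move=> x y; rewrite rmorphD; exact: ID.
  by move=> x y; rewrite rmorphM; exact: IM.
have I'1 : ~ I' 1 by rewrite /I' rmorph1.
have [sg gE] := top_coef_change l g.
have scg : size (change l g) = (msize g).-1.+1.
  apply/eqP; rewrite eqn_leq sg /=; apply: contraNT lg; rewrite -ltnNge ltnS => sz.
  by move: gE; rewrite nth_default // => /esym/eqP; rewrite mpolyC_eq0.
pose c := mpolyC n (meval l (top_form g))^-1.
have gm : c%:P * change l g \is monic.
  have cg : (c%:P * change l g)`_(msize g).-1 = 1.
    by rewrite coefCM gE -rmorphM mulVf // rmorph1.
  have sc : size (c%:P * change l g) = (msize g).-1.+1.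
    apply/eqP; rewrite eqn_leq; apply/andP; split.
      by rewrite mul_polyC (leq_trans (size_scale_leq _ _)) // scg.
    rewrite ltnNge; apply/negP => sz; move: cg; rewrite nth_default // => /esym/eqP.
    by rewrite oner_eq0.
  by rewrite monicE lead_coefE sc /= cg.
have I'g : I' (c%:P * change l g).
  by rewrite /I' rmorphM unchangeK //; exact: IM.
have I'ch p : I p -> I' (change l p) by rewrite /I' unchangeK.
clearbody I'; have [I'0 I'D I'M] := idI'.
have [a aI'] : exists a : 'I_n -> F, forall p, I' p%:P -> meval a p = 0.
  apply: IH; last by rewrite polyC1.
  split=> [|x y|x y]; rewrite ?(polyC0, polyCD, polyCM); first exact: I'0.
    exact: I'D.
  exact: I'M.
(* The fibre over [a]; it is proper by [monic_ideal_fibre_proper], and nonzero because it contains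
   the image of the monic element. *)
pose J (q : {poly F}) := exists2 p, I' p & map_poly (meval a) p = q.
have [s sJ] : exists s, forall q, J q -> q.[s] = 0.
  apply: poly_ideal_root.
  - split; first by exists 0; rewrite ?rmorph0.
      move=> _ _ [p I'p <-] [q I'q <-].
      by exists (p + q); rewrite ?rmorphD //; exact: I'D.
    move=> u _ [p I'p <-]; exists (map_poly (@mpolyC n F) u * p); first exact: I'M.
    rewrite rmorphM /= -map_poly_comp (eq_map_poly (g := idfun)) ?map_poly_id //.
    by move=> b /=; rewrite mevalC.
  - by move=> [p I'p]; apply: (monic_ideal_fibre_proper idI' I'1 I'g gm) I'p => b /aI'.
  - exists (map_poly (meval a) (c%:P * change l g)); first by exists (c%:P * change l g).
    by rewrite monic_neq0 // monic_map.
exists (change_point l a s) => p Ip; rewrite -horner_change; apply: sJ.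
by exists (change l p) => //; exact: I'ch.
Qed.

(** * From affine to projective space *)

Lemma meval_homogeneous (R : comNzRingType) (n d : nat) (p : mpoly n R)
    (c : R) (v : 'I_n -> R) :
  p \is ishomog1 d (@mdeg n) ->
  meval (fun i => c * v i) p = c ^+ d * meval v p.
Proof.
move=> /dhomogP hp; rewrite !mevalE mulr_sumr !big_seq; apply: eq_bigr => m /hp /= <-.
rewrite mulrCA; congr (_ * _); rewrite mdegE -prodrXr -big_split /=.
by apply: eq_bigr => i _; rewrite exprMn.
Qed.

(* The factor 'X_j in excess makes the homogenization vanish on 'X_j = 0. *)
Definition homogenization (R : nzRingType) (n : nat) (j : 'I_n) (e : nat)
    (p : mpoly n R) : mpoly n R :=
  mpolyX R (mnm1 j) *
  \sum_(m <- msupp p)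
     mcoeff m p *: (mpolyX R m * mpolyX R (mnm1 j) ^+ (e - mdeg m)).

Lemma homogenization_homog (R : nzRingType) n (j : 'I_n) e (p : mpoly n R) :
  (msize p <= e)%N -> homogenization j e p \is ishomog1 e.+1 (@mdeg n).
Proof.
move=> pe; rewrite -add1n; apply: dhomogM; first by rewrite dhomogX /= mdeg1.
rewrite big_seq; apply: rpred_sum => m /msize_mdeg_lt me; apply: rpredZ.
set t := (e - mdeg m)%N.
have -> : e = (mdeg m + 1 * t)%N.
  by rewrite mul1n subnKC //; apply: leq_trans pe; exact: ltnW.
by apply: dhomogM; [|apply: dhomogMn]; rewrite dhomogX /= ?mdeg1.
Qed.

Lemma meval_homogenization (F : fieldType) n (j : 'I_n) e (p : mpoly n F) v :
  (msize p <= e)%N -> v j != 0 ->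
  meval v (homogenization j e p)
  = v j ^+ e.+1 * meval (fun i => (v j)^-1 * v i) p.
Proof.
move=> pe vj; rewrite mevalM mevalXU exprS -mulrA; congr (_ * _).
rewrite raddf_sum /= mevalE mulr_sumr !big_seq; apply: eq_bigr => m mp.
rewrite mevalZ mevalM mevalX rmorphXn /= mevalXU [RHS]mulrCA; congr (_ * _).
under [in RHS]eq_bigr do rewrite exprMn.
rewrite big_split /= prodrXr -mdegE mulrA mulrC; congr (_ * _).
have me : (mdeg m <= e)%N by apply: leq_trans pe; exact/ltnW/msize_mdeg_lt.
by rewrite -{2}(subnK me) exprD -mulrA exprVn mulfV ?mulr1 // expf_neq0.
Qed.

(** The identity is claimed only at zeros of [S], so multiples of the equations in [S] disappear
    from it. On the chart v_j = 1 the affine theorem gives 1 = sum_i G_i f_i; homogenizing to a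
    common degree brings in the power of v_j. *)
Lemma projective_nullstellensatz (F : closedFieldType) (k m d : nat)
    (f : 'I_m -> mpoly k.+1 F) (S : mpoly k.+1 F -> Prop) :
    (forall i, f i \is ishomog1 d (@mdeg k.+1)) ->
    (forall g, S g -> exists e, g \is ishomog1 e (@mdeg k.+1)) ->
    (forall v : 'I_k.+1 -> F, (forall g, S g -> meval v g = 0) ->
      (forall i, meval v (f i) = 0) -> forall j, v j = 0) ->
  exists e (G : 'I_k.+1 -> 'I_m -> mpoly k.+1 F),
    (forall j i, G j i \is ishomog1 e (@mdeg k.+1)) /\
    (forall v : 'I_k.+1 -> F, (forall g, S g -> meval v g = 0) ->
      forall j, v j ^+ (e + d) = \sum_i meval v (G j i) * meval v (f i)).
Proof.
move=> fhom Shom S0.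
pose Z (v : 'I_k.+1 -> F) := forall g, S g -> meval v g = 0.
have chart j : exists G : 'I_m -> mpoly k.+1 F, forall v, Z v -> v j = 1 ->
    1 = \sum_i meval v (G i) * meval v (f i).
  (* I is an ideal containing S, the f i and 'X_j - 1, which have no common
     zero; hence 1 is in I. *)
  pose I p := exists G : 'I_m -> mpoly k.+1 F, forall v, Z v -> v j = 1 ->
    meval v p = \sum_i meval v (G i) * meval v (f i).
  suff [G GE] : I 1 by exists G => v Zv vj; rewrite -GE // meval1.
  apply: contrapT => I1; have [|v vI] := @weak_nullstellensatz F _ I _ I1.
    split.
    - exists (fun=> 0) => v _ _; rewrite meval0 big1 // => i _.
      by rewrite mul0r.
    - move=> p q [G GE] [H HE]; exists (fun i => G i + H i) => v Zv vj.
      rewrite mevalD GE // HE // -big_split; apply: eq_bigr => i _ /=.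
      by rewrite mevalD mulrDl.
    - move=> a p [G GE]; exists (fun i => a * G i) => v Zv vj.
      rewrite mevalM GE // mulr_sumr; apply: eq_bigr => i _.
      by rewrite mevalM mulrA.
  have Zv : Z v.
    move=> g Sg; apply: vI; exists (fun=> 0) => w Zw _.
    by rewrite Zw // big1 // => i _; rewrite /= meval0 mul0r.
  have fv i : meval v (f i) = 0.
    apply: vI; exists (fun i' => (i' == i)%:R) => w _ _.
    rewrite (bigD1 i) //= eqxx meval1 mul1r big1 ?addr0 // => i' /negPf ->.
    by rewrite /= meval0 mul0r.
  have : meval v (mpolyX F (mnm1 j) - 1) = 0.
    apply: vI; exists (fun=> 0) => w _ wj.
    rewrite mevalB mevalXU meval1 wj subrr big1 // => i _.
    by rewrite /= meval0 mul0r.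
  rewrite mevalB mevalXU meval1 (S0 _ Zv fv) sub0r => /eqP.
  by rewrite oppr_eq0 oner_eq0.
have [G GE] := choice chart.
pose e := \max_j \max_i msize (G j i).
have Ge j i : (msize (G j i) <= e)%N.
  by apply: leq_trans (leq_bigmax j); exact: leq_bigmax.
exists e.+1, (fun j i => homogenization j e (G j i)); split=> [j i|v Zv j].
  exact: homogenization_homog.
(* Off the chart both sides vanish, the right one thanks to the extra factor X_j in the
   homogenizations. *)
have [vj|vj] := eqVneq (v j) 0.
  rewrite vj exprD exprS !mul0r big1 // => i _.
  by rewrite /homogenization mevalM mevalXU vj !mul0r.
have Zw : Z (fun i => (v j)^-1 * v i).
  by move=> g Sg; have [e' ge] := Shom g Sg; rewrite (meval_homogeneous _ _ ge) Zv ?mulr0.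
have := GE j _ Zw (mulVf vj) => /(congr1 (fun z => v j ^+ (e.+1 + d) * z)).
rewrite mulr1 => ->; rewrite mulr_sumr; apply: eq_bigr => i _.
rewrite meval_homogenization // (meval_homogeneous _ _ (fhom i)).
rewrite exprD -!mulrA; congr (_ * _); rewrite mulrCA; congr (_ * _).
by rewrite exprVn mulrA mulfV ?mul1r // expf_neq0.
Qed.

(** * Embeddings of number fields *)

Section NumberField.

Variable K : fieldExtType rat.

Lemma pchar_number_field : [pchar K] =i pred0.
Proof. by move=> p; rewrite pchar_lalg pchar_num. Qed.

Lemma number_field_separable (U : {subfield K}) (V : {vspace K}) : separable U V.
Proof. by apply/allP => x _; apply: pcharf0_separable; exact: pchar_number_field. Qed.

Lemma number_field_primitive : exists t : K, <<1; t>>%VS = {:K}%VS.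
Proof.
exists (separable_generator 1 {:K}).
rewrite -eq_adjoin_separable_generator ?sub1v //.
exact: number_field_separable.
Qed.

End NumberField.

(** Ring morphisms from the rationals to a field are unique, so [j] can be any of them. *)
Lemma map_poly_in_alg (K : fieldExtType rat) (C : fieldType)
    (s : {rmorphism K -> C}) (j : {rmorphism rat -> C}) (q : {poly rat}) :
  map_poly s (map_poly (in_alg K) q) = map_poly j q.
Proof.
rewrite -map_poly_comp; apply: eq_map_poly => a /=.
by rewrite alg_num_field fmorph_rat fmorph_eq_rat.
Qed.

Section Embeddings.

Variables (C : fieldType) (j : {rmorphism rat -> C}).
Hypothesis rootC : forall p : {poly rat}, (1 < size p)%N ->
  exists z, root (map_poly j p) z.

Lemma eq_embedding (K : fieldExtType rat) (t : K) (s s' : {rmorphism K -> C}) :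
  <<1; t>>%VS = {:K}%VS -> s t = s' t -> s =1 s'.
Proof.
move=> tK st x; have := memvf x; rewrite -tK => /Fadjoin1_polyP[q ->].
by rewrite -!horner_map !(map_poly_in_alg _ j) st.
Qed.

(** A primitive element [t] is sent to a root [z] of its minimal polynomial. Writing x = q(t), the
    value q(z) does not depend on [q], since polynomials killing [t] also kill [z]. *)
Lemma embedding_exists (K : fieldExtType rat) : inhabited {rmorphism K -> C}.
Proof.
have [t tK] := number_field_primitive K.
have /polyOver1P[p pE] := minPolyOver 1 t.
have szp : (1 < size p)%N.
  by rewrite -(size_map_poly (in_alg K)) -pE size_minPoly.
have [z pz] := rootC szp.
have dvd q : (map_poly (in_alg K) q).[t] = 0 -> (map_poly j q).[z] = 0.
  move=> qt; have : p %| q.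
    rewrite -(dvdp_map (in_alg K)) -pE; apply: minPoly_dvdp.
      exact: alg_polyOver.
    exact/eqP.
  by move=> /dvdpP[u ->]; rewrite rmorphM hornerM (eqP pz) mulr0.
have ex x : exists q, x = (map_poly (in_alg K) q).[t].
  by apply/Fadjoin1_polyP; rewrite tK memvf.
have [q qE] := choice ex.
pose s x := (map_poly j (q x)).[z].
have sE x r : x = (map_poly (in_alg K) r).[t] -> s x = (map_poly j r).[z].
  move=> xr; apply/eqP; rewrite -subr_eq0 -hornerN -hornerD -rmorphB; apply/eqP.
  by apply: dvd; rewrite rmorphB /= hornerD hornerN -qE -xr subrr.
have s_add : zmod_morphism s.
  move=> x y; rewrite (sE (x - y) (q x - q y)).
    by rewrite rmorphB hornerD hornerN.
  by rewrite rmorphB /= hornerD hornerN -!qE.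
have s_mul : monoid_morphism s.
  split; first by rewrite (sE 1 1) ?rmorph1 ?hornerC.
  move=> x y; rewrite (sE (x * y) (q x * q y)).
    by rewrite rmorphM hornerM.
  by rewrite rmorphM /= hornerM -!qE.
pose aM := GRing.isZmodMorphism.Build K C s s_add.
pose mM := GRing.isMonoidMorphism.Build K C s s_mul.
exact: inhabits (HB.pack s aM mM : {rmorphism K -> C}).
Qed.

Section Galois.

Variables (N : splittingFieldType rat) (tau : {rmorphism N -> C}).

Lemma galois_number_field : galois 1 {:N}.
Proof.
by rewrite /galois sub1v number_field_separable normalFieldf.
Qed.

Variables (K : fieldExtType rat) (iota : {rmorphism K -> N}).

(** By normality the minimal polynomial of [iota t] is a product of factors X - g(iota t). Since
    [s t] is a root of its image under [tau], it is some tau(g(iota t)), and [t] is primitive. *)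
Lemma embedding_conjugate (s : {rmorphism K -> C}) :
  exists2 g : gal_of {:N}, g \in 'Gal({:N} / 1)%g & forall x, s x = tau (g (iota x)).
Proof.
have [t tK] := number_field_primitive K.
have [_ _ nN] := and3P galois_number_field.
have [r rG rE] := normalField_factors (sub1v _) nN (iota t) (memvf _).
have /polyOver1P[p pE] := minPolyOver 1 (iota t).
have pt : (map_poly (in_alg K) p).[t] = 0.
  apply: (fmorph_inj iota); rewrite rmorph0 -horner_map /=.
  have -> : map_poly iota (map_poly (in_alg K) p) = map_poly (in_alg N) p.
    rewrite -map_poly_comp; apply: eq_map_poly => a /=.
    by rewrite !alg_num_field fmorph_rat.
  by rewrite -pE minPolyxx.
have : root (map_poly tau (minPoly 1 (iota t))) (s t).
  by rewrite pE (map_poly_in_alg _ j) -(map_poly_in_alg s) fmorph_root; apply/eqP.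
rewrite rE rmorph_prod /=.
under eq_bigr do rewrite rmorphB /= map_polyX map_polyC /=.
rewrite -(big_map (fun g : gal_of {:N} => tau (g (iota t))) xpredT
  (fun c => 'X - c%:P)) root_prod_XsubC => /mapP[g gr stE].
exists g; first exact: (fintype.subsetP rG).
by apply: (@eq_embedding _ _ s [the {rmorphism K -> C} of tau \o g \o iota] tK).
Qed.

End Galois.

End Embeddings.

Lemma embeddingsP (K C : fieldType) (s : K -> C) :
  @embeddings K C s -> exists s' : {rmorphism K -> C}, s = s'.
Proof.
move=> [sa sm].
pose aM := GRing.isZmodMorphism.Build K C s sa.
pose mM := GRing.isMonoidMorphism.Build K C s sm.
by exists (HB.pack s aM mM : {rmorphism K -> C}).
Qed.

(** * Counting embeddings with the Galois group *)

Section ConjugateCount.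

Variables (N : splittingFieldType rat) (K : fieldExtType rat).
Variables (iota : {rmorphism K -> N}) (t : K).
Hypothesis tK : <<1; t>>%VS = {:K}%VS.

Local Notation G := ('Gal({:N} / 1)%g).
Local Notation E := (<<1; iota t>>%AS).

Lemma mem_gal_adjoin1 (g : gal_of {:N}) :
  (g \in 'Gal({:N} / E)%g) = (g \in G) && (g (iota t) == iota t).
Proof.
apply/idP/andP => [gE|[gG /eqP gt]].
  split; first by apply: fintype.subsetP gE; exact/galS/sub1v.
  by apply/eqP/(fixed_gal (subvf _) gE); rewrite memv_adjoin.
rewrite gal_kHom ?subvf //; apply/kAHomP => _ /Fadjoin1_polyP[q ->].
rewrite -horner_map /= gt; congr _.[_].
exact: (map_poly_in_alg [the {rmorphism N -> N} of g : N -> N]).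
Qed.

Lemma dim_adjoin_embedding : \dim E = \dim {:K}.
Proof.
pose lM := GRing.isScalable.Build rat K N *:%R iota (fmorph_numZ iota).
pose f : {lrmorphism K -> N} := HB.pack (iota : K -> N) iota lM.
have fE x : linfun_ahom f x = iota x := lfunE f x.
transitivity (\dim (linfun_ahom f @: {:K})).
  by rewrite -tK aimg_adjoin aimg1 fE.
rewrite limg_dim_eq //; apply/eqP; rewrite -subv0; apply/subvP => x.
by rewrite memv_cap memv_ker fE fmorph_eq0 memv0 => /andP[].
Qed.

(** The fibre is a coset of the Galois group of N over the image of K, whose order is [N:Q] /
    [K:Q]. *)
Lemma card_conjugate_fibre (g0 : gal_of {:N}) : g0 \in G ->
  (#|[set g in G | g (iota t) == g0 (iota t)]| * \dim {:K})%N = \dim {:N}.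
Proof.
move=> g0G.
have -> : [set g in G | g (iota t) == g0 (iota t)]%SET = ('Gal({:N} / E) :* g0)%g.
  apply/setP => g; rewrite inE mem_rcoset mem_gal_adjoin1 groupMr ?groupV //.
  case: (g \in G) => //=.
  rewrite -[RHS](inj_eq (fmorph_inj [the {rmorphism N -> N} of g0 : N -> N])) /=.
  by rewrite -galM ?memvf // mulgVK.
rewrite card_rcoset -galois_dim; last first.
  by apply: galoisS (galois_number_field N); rewrite sub1v subvf.
by rewrite -dim_adjoin_embedding divnK // field_dimS // subvf.
Qed.

End ConjugateCount.

Section EmbeddingSum.

Variables (C : fieldType) (j : {rmorphism rat -> C}).
Variables (N : splittingFieldType rat) (tau : {rmorphism N -> C}).
Variables (K : fieldExtType rat) (iota : {rmorphism K -> N}).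

Definition conjugate_embedding (g : gal_of {:N}) : K -> C :=
  fun x => tau (g (iota x)).

Local Notation G := ('Gal({:N} / 1)%g).

Lemma embeddings_conjugate :
  @embeddings K C = conjugate_embedding @` [set g | g \in G].
Proof.
apply/seteqP; split=> [s /embeddingsP[s' ->]|_ [g _ <-]].
  have [g gG sE] := embedding_conjugate j tau iota s'.
  by exists g => //; apply/funext => x; rewrite sE.
split=> [x y|]; first by rewrite /conjugate_embedding !rmorphB.
by split=> [|x y]; rewrite /conjugate_embedding ?rmorph1 ?rmorphM.
Qed.

Lemma finite_embeddings : finite_set (@embeddings K C).
Proof. by rewrite embeddings_conjugate; apply: finite_image; exact: finite_finset. Qed.

(** Each embedding of K comes from exactly [N:Q] / [K:Q] elements of the Galois group; multiplying
    by both degrees avoids the division. *)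
Lemma sum_embeddings (R : realType) (F : (K -> C) -> R) :
  (\dim {:N})%:R * \sum_(s \in @embeddings K C) F s =
  (\dim {:K})%:R * \sum_(g in G) F (conjugate_embedding g).
Proof.
have [t tK] := number_field_primitive K.
rewrite fsbig_finite; last exact: finite_embeddings.
rewrite /=.
set r := finmap.enum_fset _.
have memr s : s \in r -> exists2 g, g \in G & s = conjugate_embedding g.
  rewrite (in_fset_set finite_embeddings) embeddings_conjugate => /set_mem.
  by move=> [g gG <-]; exists g.
have rmem g : g \in G -> conjugate_embedding g \in r.
  move=> gG; rewrite (in_fset_set finite_embeddings); apply/mem_set.
  by rewrite embeddings_conjugate; exists g.
(* Expanding each term over all embeddings, with an indicator, allows the two sums to be
   exchanged. *)
rewrite [X in _ = _ * X](_ : _ = \sum_(g in G)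
  \sum_(s <- r) (s == conjugate_embedding g)%:R * F s).
  rewrite exchange_big /= !mulr_sumr !big_seq; apply: eq_bigr => s /memr[g0 g0G ->].
  rewrite -mulr_suml mulrA; congr (_ * _).
  rewrite -(card_conjugate_fibre iota tK g0G) mulnC natrM; congr (_ * _).
  rewrite -sum1_card natr_sum big_mkcond [RHS]big_mkcond /=.
  apply: eq_bigr => g _; rewrite inE; case: (g \in G) => //=.
  have -> : (conjugate_embedding g0 == conjugate_embedding g)
            = (g (iota t) == g0 (iota t)).
    apply/eqP/eqP => [/(congr1 (@^~ t))/fmorph_inj //|gt].
    apply/funext => x.
    by apply: (eq_embedding j (s := [the {rmorphism K -> C} of tau \o g0 \o iota])
      (s' := [the {rmorphism K -> C} of tau \o g \o iota]) tK); rewrite /= gt.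
  by case: eqP.
apply: eq_bigr => g gG.
rewrite (bigD1_seq _ (rmem g gG) (finmap.fset_uniq _)) /= eqxx mul1r big1 ?addr0 //.
by move=> s /negPf ->; rewrite mul0r.
Qed.

End EmbeddingSum.

(** * Absolute values *)

Section AbsoluteValue.

Variables (R : realType) (K : fieldType) (a : K -> R).
Hypothesis aP : absolute_value a.

Lemma absv_ge0 x : 0 <= a x. Proof. by case: aP. Qed.

Lemma absvM x y : a (x * y) = a x * a y. Proof. by case: aP. Qed.

Lemma absv_eq0 x : (a x == 0) = (x == 0).
Proof. by case: aP => _ h _ _; apply/eqP/eqP => /h. Qed.

Lemma absv0 : a 0 = 0. Proof. by apply/eqP; rewrite absv_eq0. Qed.

Lemma absv_gt0 x : (0 < a x) = (x != 0).
Proof. by rewrite lt_neqAle absv_ge0 andbT eq_sym absv_eq0. Qed.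

Lemma absv1 : a 1 = 1.
Proof.
have a1 : a 1 != 0 by rewrite absv_eq0 oner_neq0.
by apply: (mulfI a1); rewrite -absvM !mulr1.
Qed.

Lemma absvX x n : a (x ^+ n) = a x ^+ n.
Proof. by elim: n => [|n IH]; rewrite ?absv1 // !exprS absvM IH. Qed.

Lemma absvV x : a x^-1 = (a x)^-1.
Proof.
have [->|x0] := eqVneq x 0; first by rewrite invr0 absv0 invr0.
have ax0 : a x != 0 by rewrite absv_eq0.
by apply: (mulfI ax0); rewrite -absvM !divff // absv1.
Qed.

Lemma absvN1 : a (-1) = 1.
Proof.
apply/eqP; rewrite -(@eqrXn2 _ 2) ?absv_ge0 // expr1n -absvX sqrrN expr1n.
by rewrite absv1.
Qed.

Lemma absvN x : a (- x) = a x.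
Proof. by rewrite -mulN1r absvM absvN1 mul1r. Qed.

Lemma absv_prod (I : Type) (r : seq I) (P : pred I) (f : I -> K) :
  a (\prod_(i <- r | P i) f i) = \prod_(i <- r | P i) a (f i).
Proof. by elim/big_rec2: _ => [|i x y _ <-]; rewrite ?absv1 ?absvM. Qed.

Lemma absv_sum (I : Type) (r : seq I) (P : pred I) (f : I -> K) :
  a (\sum_(i <- r | P i) f i) <= \sum_(i <- r | P i) a (f i).
Proof.
elim/big_rec2: _ => [|i x y _ h]; first by rewrite absv0.
have [_ _ _ tri] := aP.
by apply: le_trans (tri _ _) _; rewrite lerD2l.
Qed.

Definition nonarchimedean := forall x y, a (x + y) <= Num.max (a x) (a y).

Lemma nonarchimedean_sum (I : Type) (r : seq I) (P : pred I) (f : I -> K) B :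
  nonarchimedean -> 0 <= B -> (forall i, P i -> a (f i) <= B) ->
  a (\sum_(i <- r | P i) f i) <= B.
Proof.
move=> na B0 fB; elim/big_rec: _ => [|i x Pi h]; first by rewrite absv0.
by apply: le_trans (na _ _) _; rewrite ge_max fB.
Qed.

(* With M = max (a x) (a y), the binomial formula bounds a (x + y) ^+ n by
   (n + 1) M ^+ n for all n. *)
Lemma nonarchimedean_natr :
  (forall n : nat, a n%:R <= 1) -> nonarchimedean.
Proof.
move=> a1 x y; set M := Num.max (a x) (a y).
have M0 : 0 <= M by rewrite le_max absv_ge0.
have aM n : a (x + y) ^+ n <= n.+1%:R * M ^+ n.
  rewrite -absvX exprDn; apply: le_trans (absv_sum _ _ _) _.
  rewrite -[n.+1 in X in _ <= X]card_ord mulr_natl -sumr_const; apply: ler_sum => i _.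
  rewrite -mulr_natl absvM absvM !absvX -[leRHS]mul1r.
  apply: ler_pM; rewrite ?mulr_ge0 ?exprn_ge0 ?absv_ge0 //.
  have iE : n = (n - i + i)%N by rewrite subnK // -ltnS.
  rewrite [n in M ^+ n]iE exprD; apply: ler_pM; rewrite ?exprn_ge0 ?absv_ge0 //.
    by apply: lerXn2r; rewrite ?nnegrE ?absv_ge0 // le_max lexx.
  by apply: lerXn2r; rewrite ?nnegrE ?absv_ge0 // le_max lexx orbT.
rewrite leNgt; apply/negP => Mlt.
have axy : 0 < a (x + y) by apply: le_lt_trans Mlt.
have [M00|Mpos] := eqVneq M 0.
  by have := aM 1; rewrite !expr1 M00 mulr0 leNgt axy.
have {}Mpos : 0 < M by rewrite lt_neqAle eq_sym Mpos.
pose h := a (x + y) / M - 1.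
have h0 : 0 < h by rewrite subr_gt0 ltr_pdivlMr // mul1r.
(* Bernoulli's inequality. Squared, it makes (1+h)^(2n) grow at least like (nh)^2, against the
   linear bound 2n+1 of [grow]. *)
have bern n : 1 + n%:R * h <= (1 + h) ^+ n.
  elim: n => [|n IH]; first by rewrite mul0r addr0.
  rewrite exprS; apply: le_trans (ler_wpM2l _ IH); last by rewrite addr_ge0 // ltW.
  have -> : (1 + h) * (1 + n%:R * h) = 1 + n.+1%:R * h + n%:R * h ^+ 2.
    by rewrite -natr1; ring.
  by rewrite lerDl mulr_ge0 ?ler0n ?sqr_ge0.
have grow n : (1 + h) ^+ n <= n.+1%:R.
  rewrite /h addrC subrK expr_div_n ler_pdivrMr ?exprn_gt0 //; exact: aM.
(* For such [n], (nh)^2 > 4n, while 4n >= 2n+1 as n >= 1. *)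
have [n hn] : exists n : nat, 4 / h ^+ 2 < n%:R.
  exists (Num.bound (4 / h ^+ 2)); apply: archi_boundP.
  by rewrite divr_ge0 // sqr_ge0.
have n1 : 1 <= n%:R :> R.
  rewrite ler1n -(ltr0n R); apply: le_lt_trans hn.
  by rewrite divr_ge0 // sqr_ge0.
rewrite ltr_pdivrMr ?exprn_gt0 // in hn.
have := grow (n * 2)%N; rewrite exprM -natr1 natrM.
have := bern n; set u := (1 + h) ^+ n => bn un.
have : (n%:R * h) ^+ 2 < u ^+ 2 by rewrite ltrXn2r ?nnegrE ?mulr_ge0 //; lra.
nra.
Qed.

End AbsoluteValue.

Lemma absolute_value_comp (R : realType) (K L : fieldType) (a : L -> R)
    (s : {rmorphism K -> L}) : absolute_value a -> absolute_value (a \o s).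
Proof.
move=> aP; split=> [x|x|x y|x y] /=.
- exact: absv_ge0.
- split=> [/eqP|->]; last by rewrite rmorph0 absv0.
  by rewrite (absv_eq0 aP) fmorph_eq0 => /eqP.
- by rewrite rmorphM absvM.
- by rewrite rmorphD; case: aP.
Qed.

Section MaxAbs.

Variables (R : realType) (K : fieldType) (a : K -> R).
Hypothesis aP : absolute_value a.

Definition max_abs (n : nat) (y : 'I_n -> K) : R :=
  \big[Num.max/0]_(i < n) a (y i).

Lemma le_max_abs n (y : 'I_n -> K) i : a (y i) <= max_abs y.
Proof. exact: (le_bigmax _ (fun i => a (y i))). Qed.

Lemma max_abs_le n (y : 'I_n -> K) B :
  0 <= B -> (forall i, a (y i) <= B) -> max_abs y <= B.
Proof. by move=> B0 yB; apply/bigmax_leP; split=> // i _. Qed.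

Lemma max_abs_ge0 n (y : 'I_n -> K) : 0 <= max_abs y.
Proof. exact: bigmax_ge_id. Qed.

Lemma max_abs_gt0 n (y : 'I_n -> K) i : y i != 0 -> 0 < max_abs y.
Proof.
by move=> yi; apply: lt_le_trans (le_max_abs y i); rewrite absv_gt0.
Qed.

Lemma max_absM n c (y : 'I_n -> K) :
  max_abs (fun i => c * y i) = a c * max_abs y.
Proof.
apply/eqP; rewrite eq_le; apply/andP; split.
  apply: max_abs_le => [|i]; first by rewrite mulr_ge0 ?absv_ge0 ?max_abs_ge0.
  by rewrite absvM // ler_wpM2l ?absv_ge0 ?le_max_abs.
have [->|c0] := eqVneq c 0; first by rewrite absv0 // mul0r max_abs_ge0.
have ac : 0 < a c by rewrite absv_gt0.
rewrite mulrC -ler_pdivlMr //; apply: max_abs_le => [|i].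
  by rewrite divr_ge0 ?max_abs_ge0 ?absv_ge0.
by rewrite ler_pdivlMr // mulrC -absvM // (le_max_abs (fun i => c * y i)).
Qed.

End MaxAbs.

Section PadicComplex.

Variables (R : realType) (p : nat) (C : padic_complex R p).
Hypothesis p_prime : prime p.

Definition pc_rat : {rmorphism rat -> C} :=
  @pc_of_Qpalg _ _ C \o @pc_of_Qp _ _ C \o @pc_of_rat _ _ C.

Lemma pc_abs_rat q : @pc_abs _ _ C (pc_rat q) = padic_abs R p q.
Proof.
have [_ abs_alg _ _] := pc_completion C.
have [_ abs_rat _ _] := pc_Qp_completion C.
by rewrite /pc_rat /= abs_alg pc_Qpalg_abs_extends abs_rat.
Qed.

Lemma pc_absolute_value : absolute_value (@pc_abs _ _ C).
Proof. by case: (pc_completion C). Qed.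

(** A root already exists in the algebraic closure of Q_p, before completion. *)
Lemma pc_root (q : {poly rat}) : (1 < size q)%N ->
  exists z, root (map_poly pc_rat q) z.
Proof.
move=> szq; have [closed _] := pc_Qpalg_closure C.
pose Q := map_poly (@pc_of_Qp _ _ C \o @pc_of_rat _ _ C) q.
have szQ : size Q = (size q).-1.+1.
  by rewrite size_map_poly prednK // (ltn_trans _ szq).
have Q0 : Q`_(size q).-1 != 0.
  have <- : lead_coef Q = Q`_(size q).-1 by rewrite lead_coefE szQ.
  by rewrite lead_coef_eq0 -size_poly_eq0 szQ.
(* The closedness axiom solves x^n = sum_(i<n) P_i x^i, so the equation is first divided by its
   leading coefficient. *)
have [|x xE] := closed (size q).-1 (fun i => - (Q`_i / Q`_(size q).-1)).
  by rewrite -ltnS prednK // (ltn_trans _ szq).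
have Qx : Q.[x] = 0.
  rewrite horner_coef szQ big_ord_recr /= xE mulr_sumr -big_split big1 // => i _ /=.
  by rewrite mulNr mulrN mulrA mulrCA divff // mulr1 subrr.
exists (pc_of_Qpalg C x); apply/eqP.
rewrite (_ : map_poly pc_rat q = map_poly (pc_of_Qpalg C) Q).
  by rewrite horner_map Qx rmorph0.
by rewrite /Q -map_poly_comp.
Qed.

Lemma padic_abs_le1 (q : rat) :
  ~~ (p %| `|denq q|%N)%N -> padic_abs R p q <= 1.
Proof.
move=> pq; rewrite /padic_abs; case: eqP => // _.
rewrite (lognE p `|denq q|) (negPf pq) !andbF expr0 mul1r.
by rewrite invf_le1 ?exprn_gt0 ?exprn_ege1 ?ler1n ?ltr0n ?prime_gt0.
Qed.

(** The definition of an absolute value includes only the triangle inequality; the ultrametric one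
    follows from |n| <= 1 for natural numbers, whose denominator is 1. *)
Lemma pc_nonarchimedean : nonarchimedean (@pc_abs _ _ C).
Proof.
apply: nonarchimedean_natr => [|n]; first exact: pc_absolute_value.
rewrite -(rmorph_nat pc_rat) pc_abs_rat; apply: padic_abs_le1.
by rewrite -[n%:R]/(n%:~R) denq_int /= Euclid_dvd1.
Qed.

End PadicComplex.

Section ComplexPlace.

Variable R : realType.

Local Notation normc := (@ComplexField.Normc.normc R).

Lemma normc_absolute_value : absolute_value normc.
Proof.
split=> [[x y]|x|x y|x y].
- exact: sqrtr_ge0.
- split=> [/ComplexField.Normc.eq0_normc //|->].
  exact: ComplexField.Normc.normc0.
- exact: ComplexField.Normc.normcM.
- exact: le_normcD.
Qed.

Definition complex_rat : {rmorphism rat -> R[i]} := @ratr R[i].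

Lemma normc_rat q : normc (complex_rat q) = `|ratr q|.
Proof.
rewrite /complex_rat /= -(fmorph_rat (real_complex R)) /=.
by rewrite expr0n addr0 sqrtr_sqr.
Qed.

Lemma complex_root (q : {poly rat}) : (1 < size q)%N ->
  exists z, root (map_poly complex_rat q) z.
Proof.
move=> szq; apply/closed_rootP; rewrite size_map_poly.
by rewrite neq_ltn szq orbT.
Qed.

End ComplexPlace.

(** * Number fields in algC *)

Section NumberFieldsInAlgC.

(** The list holds only the image of a primitive element. In this form, finitely many number fields
    can be put into one Galois field by concatenating their lists. *)
Lemma subfield_embedding (K : fieldExtType rat) (kappa : {rmorphism K -> algC}) :
  exists s : seq algC, forall (N : fieldExtType rat) (nu : {rmorphism N -> algC}),
    {in s, forall c, exists b, nu b = c} ->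
    exists iota : {rmorphism K -> N}, forall x, nu (iota x) = kappa x.
Proof.
have [t tK] := number_field_primitive K.
exists [:: kappa t] => N nu /(_ _ (mem_head _ _))[b bE].
have ex x : exists y, nu y = kappa x.
  have := memvf x; rewrite -tK => /Fadjoin1_polyP[q ->].
  exists (map_poly (in_alg N) q).[b]; rewrite -!horner_map bE.
  by rewrite !(map_poly_in_alg _ (@ratr algC)).
have [f fE] := choice ex.
have f_add : zmod_morphism f.
  by move=> x y; apply: (fmorph_inj nu); rewrite rmorphB !fE rmorphB.
have f_mul : monoid_morphism f.
  by split=> [|x y]; apply: (fmorph_inj nu); rewrite ?rmorphM !fE ?rmorph1 ?rmorphM.
pose aM := GRing.isZmodMorphism.Build K N f f_add.
pose mM := GRing.isMonoidMorphism.Build K N f f_mul.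
by exists (HB.pack f aM mM : {rmorphism K -> N}).
Qed.

(** The field generated by all roots of the minimal polynomials of the members of [s] is the
    splitting field of their product. *)
Lemma galois_field_exists (s : seq algC) :
  exists (N : splittingFieldType rat) (nu : {rmorphism N -> algC}),
    {in s, forall c, exists b, nu b = c}.
Proof.
pose roots c := sval (closed_field_poly_normal (minCpoly c)).
have rootsE c : minCpoly c = \prod_(z <- roots c) ('X - z%:P).
  rewrite /roots; case: closed_field_poly_normal => r /= ->.
  by rewrite (monicP (minCpoly_monic c)) scale1r.
have [K [kappa [s1 s1E s1K]]] := num_field_exists (flatten (map roots s)).
have split : splitting_field_axiom K.
  exists (\prod_(x <- s1) ('X - x%:P)); last first.
    by exists s1; [exact: eqpxx | exact: s1K].
  apply/polyOver1P; exists (\prod_(c <- s) sval (minCpolyP c)).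
  apply: (map_poly_inj kappa); rewrite (map_poly_in_alg _ (@ratr algC)).
  rewrite !rmorph_prod /=.
  under eq_bigr do rewrite rmorphB /= map_polyX map_polyC /=.
  rewrite -(big_map kappa xpredT (fun z => 'X - z%:P)) s1E big_flatten big_map.
  apply: eq_bigr => c _; rewrite -rootsE.
  by case: minCpolyP => q [].
pose sM := FieldExt_isSplittingField.Build rat K split.
pose N : splittingFieldType rat := HB.pack (FieldExt.sort K) sM.
exists N, kappa => c cs.
have : c \in map kappa s1.
  rewrite s1E; apply/flattenP; exists (roots c); first exact: map_f.
  by rewrite -root_prod_XsubC -rootsE root_minCpoly.
by move=> /mapP[b _ ->]; exists b.
Qed.

End NumberFieldsInAlgC.

(** * The product formula *)

Section SumOverPrimes.

Variable R : realType.

Definition primes_dividing (D : nat) : set prime_number :=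
  [set p | (val p %| D)%N].

Lemma finite_primes_dividing D : (0 < D)%N -> finite_set (primes_dividing D).
Proof.
move=> D0; apply: (@sub_finite_set _ _ (val @^-1` `I_D.+1)).
  by move=> p /= pD; rewrite ltnS dvdn_leq.
by apply: finite_preimage; [move=> x y _ _ /val_inj | exact: finite_II].
Qed.

(** Finite support, witnessed by one integer: two such conditions combine by multiplying the
    integers. *)
Definition almost_zero (F : prime_number -> R) : Prop :=
  exists2 D, (0 < D)%N & forall p, ~~ (val p %| D)%N -> F p = 0.

Lemma sum_primesE D (F : prime_number -> R) : (0 < D)%N ->
  (forall p, ~~ (val p %| D)%N -> F p = 0) ->
  \sum_(p \in [set: prime_number]) F p = \sum_(p \in primes_dividing D) F p.
Proof.
move=> D0 FD; apply/esym/fsbig_widen => // p [_ /= /negP pD].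
exact: FD.
Qed.

Lemma almost_zero2 (F G : prime_number -> R) :
  almost_zero F -> almost_zero G ->
  exists2 D, (0 < D)%N & forall p, ~~ (val p %| D)%N -> F p = 0 /\ G p = 0.
Proof.
move=> [D D0 FD] [E E0 GE]; exists (D * E)%N; first by rewrite muln_gt0 D0.
by move=> p; rewrite Euclid_dvdM ?(valP p) // negb_or => /andP[/FD -> /GE ->].
Qed.

Lemma almost_zeroD (F G : prime_number -> R) :
  almost_zero F -> almost_zero G -> almost_zero (fun p => F p + G p).
Proof.
move=> F0 G0; have [D D0 DE] := almost_zero2 F0 G0.
by exists D => // p /DE[-> ->]; rewrite addr0.
Qed.

Lemma almost_zeroM c (F : prime_number -> R) :
  almost_zero F -> almost_zero (fun p => c * F p).
Proof. by move=> [D D0 FD]; exists D => // p /FD ->; rewrite mulr0. Qed.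

Lemma sum_primesD (F G : prime_number -> R) :
  almost_zero F -> almost_zero G ->
  \sum_(p \in [set: prime_number]) (F p + G p) =
  \sum_(p \in [set: prime_number]) F p + \sum_(p \in [set: prime_number]) G p.
Proof.
move=> F0 G0; have [D D0 DE] := almost_zero2 F0 G0.
rewrite !(sum_primesE D0) ?fsbig_split //; first exact: finite_primes_dividing.
- by move=> p /DE[_ ->].
- by move=> p /DE[-> _].
- by move=> p /DE[-> ->]; rewrite addr0.
Qed.

Lemma le_sum_primes (F G : prime_number -> R) :
  almost_zero F -> almost_zero G -> (forall p, F p <= G p) ->
  \sum_(p \in [set: prime_number]) F p <= \sum_(p \in [set: prime_number]) G p.
Proof.
move=> F0 G0 FG; have [D D0 DE] := almost_zero2 F0 G0.
have finD := finite_primes_dividing D0.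
rewrite !(sum_primesE D0).
- by rewrite !(fsbig_finite _ _ finD); apply: ler_sum.
- by move=> p /DE[_ ->].
- by move=> p /DE[-> _].
Qed.

Lemma almost_zero_logn n : (0 < n)%N ->
  almost_zero (fun p : prime_number => (logn (val p) n)%:R * ln ((val p)%:R : R)).
Proof.
by move=> n0; exists n => // p pn; rewrite lognE (negPf pn) !andbF mul0r.
Qed.

(** The logarithm of the prime factorization, by strong induction, splitting off the smallest prime
    divisor. *)
Lemma sum_primes_logn n : (0 < n)%N ->
  \sum_(p \in [set: prime_number]) (logn (val p) n)%:R * ln ((val p)%:R : R)
  = ln n%:R.
Proof.
have [N] := ubnP n; elim: N n => // N IH n nN n0.
have [n1|n1] := leqP n 1.
  have -> : n = 1%N by apply/eqP; rewrite eqn_leq n1.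
  by rewrite ln1 fsbig1 // => p _; rewrite logn1 mul0r.
have pr := pdiv_prime n1; pose P : prime_number := exist _ (pdiv n) pr.
have nE : n = (pdiv n * (n %/ pdiv n))%N by rewrite mulnC divnK ?pdiv_dvd.
set m := (n %/ pdiv n)%N in nE.
have m0 : (0 < m)%N by move: n0; rewrite nE muln_gt0 => /andP[].
have mN : (m < N)%N.
  apply: (@leq_trans n); last by rewrite -ltnS.
  by rewrite [n in (_ <= n)%N]nE ltn_Pmull // prime_gt1.
have -> : \sum_(p \in [set: prime_number]) (logn (val p) n)%:R * ln ((val p)%:R : R)
  = \sum_(p \in [set: prime_number]) ((logn (val p) (pdiv n))%:R * ln ((val p)%:R : R)
      + (logn (val p) m)%:R * ln ((val p)%:R : R)).
  apply: eq_fsbigr => p _; rewrite -mulrDl -natrD; congr (_%:R * _).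
  by rewrite [in LHS]nE lognM // prime_gt0.
rewrite sum_primesD; try by apply: almost_zero_logn => //; exact: prime_gt0.
transitivity (ln ((pdiv n * m)%N%:R : R)); last by rewrite -nE.
rewrite (IH m) // natrM lnM ?posrE ?ltr0n ?pdiv_gt0 //.
rewrite -(@fsbig_widen _ _ _ _ [set P]) //.
  by rewrite fsbig_set1 /= logn_prime // eqxx mul1r.
move=> p [_ /= pP]; rewrite logn_prime ?(valP p) //.
case: eqP => [e|]; last by rewrite mul0r.
by case: pP; apply: val_inj.
Qed.

Lemma ln_padic_abs (p : nat) (q : rat) : prime p -> q != 0 ->
  ln (padic_abs R p q) = (logn p `|denq q|%N)%:R * ln p%:R
                         - (logn p `|numq q|%N)%:R * ln p%:R.
Proof.
move=> pr q0; rewrite /padic_abs (negPf q0).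
have p0 : 0 < p%:R :> R by rewrite ltr0n prime_gt0.
by rewrite ln_div ?posrE ?exprn_gt0 // !lnXn // !mulr_natl.
Qed.

Lemma almost_zero_padic q : q != 0 ->
  almost_zero (fun p : prime_number => ln (padic_abs R (val p) q)).
Proof.
move=> q0.
have dq : (0 < `|denq q|)%N by rewrite absz_gt0 denq_neq0.
have nq : (0 < `|numq q|)%N by rewrite absz_gt0 numq_eq0.
have [D D0 DE] :=
  almost_zeroD (almost_zero_logn dq) (almost_zeroM (-1) (almost_zero_logn nq)).
by exists D => // p /DE <-; rewrite ln_padic_abs ?(valP p) // mulN1r.
Qed.

Lemma rat_product_formula q : q != 0 ->
  \sum_(p \in [set: prime_number]) ln (padic_abs R (val p) q)
  + ln `|ratr q : R| = 0.
Proof.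
move=> q0.
have dq : (0 < `|denq q|)%N by rewrite absz_gt0 denq_neq0.
have nq : (0 < `|numq q|)%N by rewrite absz_gt0 numq_eq0.
have -> : \sum_(p \in [set: prime_number]) ln (padic_abs R (val p) q)
  = \sum_(p \in [set: prime_number])
      ((logn (val p) `|denq q|%N)%:R * ln ((val p)%:R : R)
       + -1 * ((logn (val p) `|numq q|%N)%:R * ln ((val p)%:R : R))).
  by apply: eq_fsbigr => p _; rewrite ln_padic_abs ?(valP p) // mulN1r.
rewrite sum_primesD; first last.
- by apply/almost_zeroM/almost_zero_logn.
- exact: almost_zero_logn.
rewrite -mulr_fsumr !sum_primes_logn // mulN1r.
rewrite /ratr normrM normrV ?unitfE ?intr_eq0 ?denq_neq0 //.
rewrite -!intr_norm -!natr_absz ln_div ?posrE ?ltr0n //.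
by rewrite addrC addrA subrK subrr.
Qed.

End SumOverPrimes.

(** * Heights over number fields *)

(** If |z| > 1, the equation expresses z^(n+1) through lower powers with coefficients of size at
    most 1, whence |z|^(n+1) <= |z|^n, a contradiction. *)
Lemma integral_absv_le1 (R : realType) (C : fieldType) (a : C -> R)
    (q : {poly C}) (z : C) :
  absolute_value a -> nonarchimedean a -> q \is monic ->
  (forall i, a q`_i <= 1) -> root q z -> a z <= 1.
Proof.
move=> aP na qm q1 qz; rewrite leNgt; apply/negP => az.
have q0 : q != 0 by rewrite monic_neq0.
case szq : (size q) => [|[|n]].
- by move/eqP: szq; rewrite size_poly_eq0 (negPf q0).
- have := root_size_gt1 q0 qz; by rewrite szq.
have qn : q`_n.+1 = 1 by have := monicP qm; rewrite lead_coefE szq.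
have zE : z ^+ n.+1 = - \sum_(i < n.+1) q`_i * z ^+ i.
  move/eqP: qz; rewrite horner_coef szq big_ord_recr /= qn mul1r => /eqP.
  by rewrite addrC addr_eq0 => /eqP.
have : a (z ^+ n.+1) <= a z ^+ n.
  rewrite zE absvN //; apply: nonarchimedean_sum => //.
    by rewrite exprn_ge0 // absv_ge0.
  move=> i _; rewrite absvM // absvX // -[leRHS]mul1r.
  apply: ler_pM; rewrite ?exprn_ge0 ?absv_ge0 //.
  by rewrite ler_weXn2l ?(ltW az) // -ltnS.
rewrite absvX // exprS -ler_pdivlMr ?exprn_gt0 ?(lt_trans _ az) //.
by rewrite divff ?expf_neq0 ?gt_eqF ?(lt_trans _ az) // leNgt az.
Qed.

Section LocalHeights.

Variables (R : realType) (Cp : forall p : prime_number, padic_complex R (val p)).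

Local Notation pabs p := (@pc_abs R _ (Cp p)).
Local Notation normc := (fun z : R[i] => ComplexField.Normc.normc z).

Lemma almost_integral (K : fieldExtType rat) (z : K) :
  exists2 D, (0 < D)%N & forall p : prime_number, ~~ (val p %| D)%N ->
    forall s : {rmorphism K -> Cp p}, pabs p (s z) <= 1.
Proof.
have /polyOver1P[q qE] := minPolyOver 1 z.
(* At primes dividing none of these denominators, the minimal polynomial of [z] has integral
   coefficients. *)
exists (\prod_(i < size q) `|denq q`_i|%N)%N.
  by apply: prodn_gt0 => i; rewrite absz_gt0 denq_neq0.
move=> p pD s; apply: (@integral_absv_le1 _ _ _ (map_poly (pc_rat (Cp p)) q)).
- exact: pc_absolute_value.
- by apply: pc_nonarchimedean; exact: (valP p).
- rewrite monic_map //.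
  by rewrite -(map_monic (in_alg K)) -qE monic_minPoly.
- move=> i; rewrite coef_map pc_abs_rat; apply: padic_abs_le1; first exact: (valP p).
  have [iq|qi] := ltnP i (size q); last first.
    by rewrite nth_default // Euclid_dvd1 ?(valP p).
  apply: contra pD => pi; apply: dvdn_trans pi _.
  by rewrite (bigD1 (Ordinal iq)) //= dvdn_mulr.
- by rewrite -(map_poly_in_alg s) -qE fmorph_root root_minPoly.
Qed.

Lemma almost_unit (K : fieldExtType rat) (z : K) : z != 0 ->
  exists2 D, (0 < D)%N & forall p : prime_number, ~~ (val p %| D)%N ->
    forall s : {rmorphism K -> Cp p}, pabs p (s z) = 1.
Proof.
move=> z0; have [D D0 DE] := almost_integral z.
have [E E0 EE] := almost_integral z^-1.
exists (D * E)%N => [|p]; first by rewrite muln_gt0 D0.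
rewrite Euclid_dvdM ?(valP p) // negb_or => /andP[/DE Dp /EE Ep] s.
have aP := pc_absolute_value (Cp p).
apply/eqP; rewrite eq_le Dp /=; have := Ep s.
by rewrite fmorphV absvV // invf_le1 // absv_gt0 // fmorph_eq0.
Qed.

(** Away from finitely many primes every nonzero coordinate is a unit under all embeddings, so the
    maximum is 1 and its logarithm 0. *)
Lemma almost_zero_local_height (K : fieldExtType rat) n (y : 'I_n -> K) :
  almost_zero (fun p => local_height (pabs p) y).
Proof.
have /choice[D DE] : forall i, exists D, (0 < D)%N /\
    forall p : prime_number, ~~ (val p %| D)%N ->
    forall s : {rmorphism K -> Cp p}, y i != 0 -> pabs p (s (y i)) = 1.
  move=> i; have [->|yi] := eqVneq (y i) 0; first by exists 1%N.
  by have [D D0 DE] := almost_unit yi; exists D; split=> // p /DE.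
exists (\prod_i D i)%N => [|p pD]; first by apply: prodn_gt0 => i; case: (DE i).
have pDi i : ~~ (val p %| D i)%N.
  by apply: contra pD => pi; apply: dvdn_trans pi _; rewrite (bigD1 i) //= dvdn_mulr.
have aP := pc_absolute_value (Cp p).
rewrite /local_height fsbig1 // => _ /embeddingsP[s ->].
(* If all coordinates vanish, the convention ln 0 = 0 applies. *)
have [[i yi]|y0] := pselect (exists i, y i != 0); last first.
  rewrite (_ : \big[_/_]_(i < n) _ = 0) ?ln0 //.
  elim/big_ind: _ => // [u v -> ->|i _]; first exact: maxxx.
  have -> : y i = 0 by apply/eqP/negP => /negP yi; case: y0; exists i.
  by rewrite rmorph0 absv0.
rewrite -[X in ln X]/(max_abs (pabs p \o s) y) (_ : max_abs _ _ = 1) ?ln1 //.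
have aPs := absolute_value_comp s aP.
have one j : y j != 0 -> pabs p (s (y j)) = 1 by case: (DE j) => _; apply.
apply/eqP; rewrite eq_le; apply/andP; split; last first.
  by rewrite -(one i yi); exact: (le_max_abs (pabs p \o s)).
apply: max_abs_le => // j /=; have [->|/one -> //] := eqVneq (y j) 0.
by rewrite rmorph0 absv0.
Qed.

Section Galois.

Variables (C : fieldType) (j : {rmorphism rat -> C}) (a : C -> R).
Hypothesis rootC : forall p : {poly rat}, (1 < size p)%N ->
  exists z, root (map_poly j p) z.
Hypothesis aP : absolute_value a.

Variable N : splittingFieldType rat.

Local Notation G := ('Gal({:N} / 1)%g).

Lemma dim_neq0 (K : fieldExtType rat) : (\dim {:K})%:R != 0 :> R.
Proof. by rewrite pnatr_eq0 -lt0n adim_gt0. Qed.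

Lemma card_Gal : #|G| = \dim {:N}.
Proof. by rewrite -galois_dim ?galois_number_field // dimv1 divn1. Qed.

Lemma local_heightE : exists tau : {rmorphism N -> C},
  forall n (y : 'I_n -> N),
    local_height a y = \sum_(g in G) ln (max_abs (a \o tau \o g) y).
Proof.
have [tau] := embedding_exists rootC N.
exists tau => n y; apply: (mulfI (dim_neq0 N)).
exact: (sum_embeddings j tau [the {rmorphism N -> N} of idfun]
  (fun s => ln (max_abs (a \o s) y))).
Qed.

Lemma local_height_extension (K : fieldExtType rat) (iota : {rmorphism K -> N})
    n (y : 'I_n -> K) :
  (\dim {:N})%:R * local_height a y = (\dim {:K})%:R * local_height a (iota \o y).
Proof.
have [tau tauE] := local_heightE; rewrite tauE.
have := sum_embeddings j tau iota (fun s => ln (max_abs (a \o s) y)).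
exact.
Qed.

(** Scaling by [c] adds the sum over g of ln |tau(g c)|, which is the logarithm of the absolute
    value of the norm of [c]. *)
Lemma local_height_scale c q n (y : 'I_n -> N) :
  c != 0 -> (exists i, y i != 0) -> galNorm 1 {:N} c = q%:A ->
  local_height a (fun i => c * y i) = ln (a (j q)) + local_height a y.
Proof.
move=> c0 [i yi] cq; have [tau tauE] := local_heightE; rewrite !tauE.
have -> : j q = tau (galNorm 1 {:N} c).
  by rewrite cq alg_num_field fmorph_rat fmorph_eq_rat.
rewrite /galNorm rmorph_prod /= absv_prod //.
have -> : ln (\prod_(g in G) a (tau (g c))) = \sum_(g in G) ln (a (tau (g c))).
  (* Positivity of the partial products is carried through the induction, for [lnM]. *)
  suff [] : ln (\prod_(g in G) a (tau (g c))) = \sum_(g in G) ln (a (tau (g c)))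
    /\ 0 < \prod_(g in G) a (tau (g c)) by [].
  elim/big_rec2: _ => [|g x u _ [<- u0]]; first by rewrite ln1.
  have g0 : 0 < a (tau (g c)) by rewrite absv_gt0 // !fmorph_eq0.
  by rewrite lnM ?posrE // mulr_gt0.
rewrite -big_split; apply: eq_bigr => g _ /=.
have gP := absolute_value_comp [the {rmorphism N -> C} of tau \o g] aP.
rewrite (max_absM gP) lnM ?posrE //; first by rewrite (absv_gt0 gP).
exact: (max_abs_gt0 gP yi).
Qed.

Lemma local_height_le (b l n r s : nat) (k : R)
    (z : 'I_b -> N) (c : 'I_l -> N) (y : 'I_n -> N) :
  (forall tau : {rmorphism N -> C},
    ln (max_abs (a \o tau) z) *+ r <=
    ln (max_abs (a \o tau) c) + ln (max_abs (a \o tau) y) *+ s + k) ->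
  local_height a z *+ r <=
    local_height a c + local_height a y *+ s + (\dim {:N})%:R * k.
Proof.
move=> h; have [tau tauE] := local_heightE; rewrite !tauE.
rewrite -card_Gal mulr_natl -sumr_const -!sumrMnl -!big_split /=.
by apply: ler_sum => g _; exact: (h [the {rmorphism N -> C} of tau \o g]).
Qed.

End Galois.

Lemma galNorm_rat (N : splittingFieldType rat) (c : N) : c != 0 ->
  exists2 q : rat, q != 0 & galNorm 1 {:N} c = q%:A.
Proof.
move=> c0; have /vlineP[q qE] := mem_galNorm (galois_number_field N) (memvf c).
exists q => //; apply: contraNneq c0 => q0.
by rewrite -(galNorm_eq0 1 {:N}) qE q0 scale0r.
Qed.

Lemma height_in_extension (K : fieldExtType rat) (N : splittingFieldType rat)
    (iota : {rmorphism K -> N}) n (y : 'I_n -> K) :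
  height_in Cp (iota \o y) = height_in Cp y.
Proof.
have K0 := dim_neq0 K; have N0 := dim_neq0 N.
rewrite /height_in; apply: (mulfI N0); rewrite mulVKf //.
apply: (mulfI K0); rewrite [RHS]mulrCA mulVKf //.
rewrite !mulrDr; congr (_ + _).
  rewrite !mulr_fsumr; apply: eq_fsbigr => p _.
  apply/esym/(local_height_extension (j := pc_rat (Cp p))).
  exact: pc_root.
have h := local_height_extension normc (@complex_root R) iota y.
exact/esym/h.
Qed.

Lemma height_in_scale (N : splittingFieldType rat) c n (y : 'I_n -> N) :
  c != 0 -> (exists i, y i != 0) ->
  height_in Cp (fun i => c * y i) = height_in Cp y.
Proof.
move=> c0 yi; have [q q0 cq] := galNorm_rat c0; rewrite /height_in; congr (_ * _).
have -> : \sum_(p \in [set: prime_number]) local_height (pabs p) (fun i => c * y i)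
  = \sum_(p \in [set: prime_number])
     (ln (padic_abs R (val p) q) + local_height (pabs p) y).
  apply: eq_fsbigr => p _; rewrite -(pc_abs_rat (Cp p)).
  apply: local_height_scale => //; first exact: pc_root.
  exact: pc_absolute_value.
rewrite sum_primesD; first last.
- exact: almost_zero_local_height.
- exact: almost_zero_padic.
rewrite (local_height_scale (j := complex_rat R) (@complex_root R)
  (normc_absolute_value R) c0 yi cq) normc_rat.
by rewrite addrACA rat_product_formula // add0r.
Qed.

(** Passage from inequalities at each place to heights. The constant [k] is allowed only at the
    archimedean place, where it occurs [N:Q] times and so contributes [k] after normalization. *)
Lemma height_in_le (N : splittingFieldType rat) (b l n r s : nat) (k : R)
    (z : 'I_b -> N) (c : 'I_l -> N) (y : 'I_n -> N) :
  (forall a : N -> R, absolute_value a -> nonarchimedean a ->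
    ln (max_abs a z) *+ r <= ln (max_abs a c) + ln (max_abs a y) *+ s) ->
  (forall a : N -> R, absolute_value a ->
    ln (max_abs a z) *+ r <= ln (max_abs a c) + ln (max_abs a y) *+ s + k) ->
  height_in Cp z *+ r <= height_in Cp c + height_in Cp y *+ s + k.
Proof.
move=> hna ha; have N0 : 0 < (\dim {:N})%:R :> R by rewrite ltr0n adim_gt0.
rewrite /height_in -!mulrnAr -mulrDr.
have -> : k = (\dim {:N})%:R^-1 * ((\dim {:N})%:R * k).
  by rewrite mulKf // lt0r_neq0.
rewrite -mulrDr ler_pM2l ?invr_gt0 //.
rewrite !mulrnDl addrACA -[leRHS]addrA; apply: lerD; last first.
  apply: (local_height_le (j := complex_rat R)); first exact: complex_root.
  move=> tau; apply: ha; exact/absolute_value_comp/normc_absolute_value.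
rewrite -[(\sum_(p \in _) _) *+ r]mulr_natl -[(\sum_(p \in _) _) *+ s]mulr_natl.
rewrite !mulr_fsumr -sum_primesD; first last.
- exact/almost_zeroM/almost_zero_local_height.
- exact: almost_zero_local_height.
apply: le_sum_primes.
- exact/almost_zeroM/almost_zero_local_height.
- apply: almost_zeroD; first exact: almost_zero_local_height.
  exact/almost_zeroM/almost_zero_local_height.
move=> p; rewrite !mulr_natl -[leRHS]addr0 -(mulr0 (\dim {:N})%:R).
apply: (local_height_le (j := pc_rat (Cp p))); first exact: pc_root.
move=> tau; rewrite addr0; apply: hna.
  exact/absolute_value_comp/pc_absolute_value.
by move=> u v /=; rewrite rmorphD; apply: pc_nonarchimedean; exact: (valP p).
Qed.

End LocalHeights.

(** * Heights of points and of their images *)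

Lemma max_abs_attained (R : realType) (K : fieldType) (a : K -> R) n
    (y : 'I_n -> K) :
  0 < max_abs a y -> exists i, max_abs a y = a (y i).
Proof.
rewrite lt_neqAle eq_sym => /andP[y0 _].
have [y00|//] : max_abs a y = 0 \/ exists i, max_abs a y = a (y i).
  rewrite /max_abs; elim/big_ind: _ => [|u v hu hv|i _]; first by left.
    by rewrite /Num.max; case: ifP.
  by right; exists i.
by rewrite y00 eqxx in y0.
Qed.

Section FormBound.

Variables (R : realType) (N : fieldType) (nu : {rmorphism N -> algC}).
Variables (cs : seq algC) (c : 'I_(size cs) -> N).
Hypothesis cE : forall i, nu (c i) = cs`_i.
Variables (n e : nat) (p : mpoly n algC).
Hypotheses (p_homog : homogeneous e p)
  (p_coef : {in msupp p, forall m, mcoeff m p \in cs}).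

(** The lift [w] of the value is chosen before the absolute value, so that one element of N serves
    all places. Each monomial is bounded by max|c| max|v|^e; counting them matters only in the
    archimedean case. *)
Lemma form_bound (v : 'I_n -> N) :
  exists2 w, nu w = meval (nu \o v) p &
    forall a : N -> R, absolute_value a ->
      a w <= (size (msupp p))%:R * (max_abs a c * max_abs a v ^+ e) /\
      (nonarchimedean a -> a w <= max_abs a c * max_abs a v ^+ e).
Proof.
have /choice[b bE] : forall m, exists b, m \in msupp p -> nu b = mcoeff m p /\
    forall a : N -> R, a b <= max_abs a c.
  move=> m; have [mp|mp] := boolP (m \in msupp p); last by exists 0.
  have /(nthP 0)[i ics iE] := p_coef mp; exists (c (Ordinal ics)) => _.
  by rewrite cE /= iE; split=> // a; exact: le_max_abs.
exists (\sum_(m <- msupp p) b m * \prod_i v i ^+ m i).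
  rewrite mevalE rmorph_sum !big_seq; apply: eq_bigr => m mp.
  rewrite rmorphM (bE m mp).1 rmorph_prod; congr (_ * _).
  by apply: eq_bigr => i _; rewrite rmorphXn.
move=> a aP.
have term m : m \in msupp p ->
    a (b m * \prod_i v i ^+ m i) <= max_abs a c * max_abs a v ^+ e.
  move=> mp; rewrite absvM // absv_prod //.
  have <- : mdeg m = e by have /dhomogP := p_homog; exact.
  rewrite mdegE -prodrXr; apply: ler_pM; rewrite ?absv_ge0 ?prodr_ge0 //.
  - by move=> i _; rewrite absv_ge0.
  - exact: (bE m mp).2.
  - apply: ler_prod => i _; rewrite absv_ge0 //= absvX //.
    by apply: lerXn2r; rewrite ?nnegrE ?absv_ge0 ?max_abs_ge0 ?le_max_abs.
split=> [|na].
  apply: le_trans (absv_sum aP _ _ _) _; rewrite big_seq.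
  apply: le_trans (ler_sum _ term) _.
  by rewrite -big_seq big_const_seq count_predT iter_addr_0 mulr_natl.
rewrite big_seq; apply: nonarchimedean_sum => //.
by rewrite mulr_ge0 ?exprn_ge0 ?max_abs_ge0.
Qed.

End FormBound.

Section HeightOfPoints.

Variables (R : realType) (Cp : forall p : prime_number, padic_complex R (val p)).

(** Replaces the unspecified field in [height] by any Galois field containing a finite list. *)
Lemma height_coords n (x : proj_space algC n) :
  exists s : seq algC,
    forall (N : splittingFieldType rat) (nu : {rmorphism N -> algC}),
    {in s, forall c, exists b, nu b = c} ->
    forall y : 'I_n.+1 -> N, (forall i, nu (y i) = coords x 0 i) ->
    height Cp x = height_in Cp y.
Proof.
rewrite /height; case: (num_field_exists _) => K [kappa [t tE _]].
have [s sE] := subfield_embedding kappa; exists s => N nu /sE[iota iotaE] y yE.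
rewrite -(height_in_extension Cp iota); congr height_in.
apply/funext => i; apply: (fmorph_inj nu); rewrite /= iotaE yE.
have szt : size t = n.+1 by rewrite -(size_map kappa) tE size_map size_enum_ord.
rewrite -(nth_map 0 0 kappa) ?szt // tE (nth_map ord0) ?size_enum_ord //.
by rewrite nth_ord_enum.
Qed.

Lemma coords_proj_point (F : fieldType) n (v : 'rV[F]_n.+1) (v0 : v != 0) :
  exists2 c, c != 0 & coords (proj_point v0) = c *: v.
Proof.
have : collinear (exist _ v v0 : nzvec F n) (repr (proj_point v0)).
  by apply/(@eqmodP _ (collinear_equiv F n)); rewrite reprK.
by move=> /asboolP[c [c0 cE]]; exists c.
Qed.

Lemma coords_neq0 (F : fieldType) n (x : proj_space F n) :
  exists i, coords x 0 i != 0.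
Proof.
by have /rV0Pn := valP (repr x).
Qed.

(** The chosen representative is a multiple of [v]; the factor joins the list so that the rescaling
    takes place in N. *)
Lemma height_proj_point n (v : 'rV[algC]_n.+1) (v0 : v != 0) :
  exists s : seq algC,
    forall (N : splittingFieldType rat) (nu : {rmorphism N -> algC}),
    {in s, forall c, exists b, nu b = c} ->
    forall y : 'I_n.+1 -> N, (forall i, nu (y i) = v 0 i) ->
    height Cp (proj_point v0) = height_in Cp y.
Proof.
have [c c0 cE] := coords_proj_point v0.
have [s sE] := height_coords (proj_point v0); exists (c :: s) => N nu nuE y yE.
have [b bE] := nuE c (mem_head _ _).
have b0 : b != 0 by rewrite -(fmorph_eq0 nu) bE.
rewrite -(height_in_scale Cp b0); last first.
  have /rV0Pn[i vi] := v0; exists i.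
  by rewrite -(fmorph_eq0 nu) yE.
apply: (sE N nu) => [z zs|i].
  by apply: nuE; rewrite inE zs orbT.
by rewrite cE mxE rmorphM bE yE.
Qed.

(** The coefficient vector has the same height in every large enough N, so the constants in the
    estimates do not depend on the point, although N does. *)
Lemma height_in_const (cs : seq algC) :
  exists (H : R) (s : seq algC),
    forall (N : splittingFieldType rat) (nu : {rmorphism N -> algC}),
    {in s, forall c, exists b, nu b = c} ->
    exists2 c : 'I_(size cs) -> N, forall i, nu (c i) = cs`_i &
      height_in Cp c = H.
Proof.
have [N0 [nu0 nu0E]] := galois_field_exists cs.
have /choice[c0 c0E] : forall i : 'I_(size cs), exists b, nu0 b = cs`_i.
  by move=> i; apply: nu0E; exact: mem_nth.
have [s sE] := subfield_embedding nu0.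
exists (height_in Cp c0), s => N nu /sE[iota iotaE].
exists (iota \o c0); first by move=> i; rewrite /= iotaE.
exact: height_in_extension.
Qed.

End HeightOfPoints.

(* The 1 in front keeps the maximum of the absolute values positive. *)
Definition coefficients (n : nat) (I : finType) (p : I -> mpoly n algC) : seq algC :=
  1 :: flatten [seq [seq mcoeff m (p i) | m <- msupp (p i)] | i <- enum I].

Lemma mem_coefficients n (I : finType) (p : I -> mpoly n algC) i :
  {in msupp (p i), forall m, mcoeff m (p i) \in coefficients p}.
Proof.
move=> m mp; rewrite inE; apply/orP; right; apply/flattenP.
exists [seq mcoeff m (p i) | m <- msupp (p i)]; last exact: map_f.
by apply: (map_f (fun i => [seq mcoeff m (p i) | m <- msupp (p i)])); rewrite mem_enum.
Qed.

(** * The upper and lower bounds *)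

Section Estimates.

Variables (R : realType) (Cp : forall p : prime_number, padic_complex R (val p)).
Variables (k m d : nat) (f : 'I_m.+1 -> mpoly k.+1 algC).
Hypothesis f_homog : forall i, homogeneous d (f i).

Lemma msupp_size_le (I : finType) n (p : I -> mpoly n algC) i :
  (size (msupp (p i)) <= (\sum_i size (msupp (p i))).+1)%N.
Proof. by rewrite (bigD1 i) //= ltnW // ltnS leq_addr. Qed.

Lemma height_ratmap_le :
  exists c1 : R, forall (x : proj_space algC k) (hx : ~ indeterminacy f x),
    height Cp (ratmap hx) <= d%:R * height Cp x + c1.
Proof.
have [H [s0 s0E]] := height_in_const Cp (coefficients f).
(* Bounds the number of monomials of every [f i]; the successor keeps it positive for the
   logarithm. *)
pose L := (\sum_i size (msupp (f i))).+1.
exists (H + ln L%:R) => x hx.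
have [sx sxE] := height_coords Cp x.
have [sy syE] := height_proj_point Cp (ratmap_coords_neq0 hx).
have [N [nu nuE]] :=
  galois_field_exists (s0 ++ sx ++ sy ++ [seq coords x 0 i | i <- enum 'I_k.+1]).
have sub t : {subset t <= s0 ++ sx ++ sy ++ [seq coords x 0 i | i <- enum 'I_k.+1]} ->
    {in t, forall c, exists b, nu b = c} by move=> tsub c /tsub; exact: nuE.
have [|c cE cH] := s0E N nu; first by apply: sub => z; rewrite !mem_cat => ->.
have /choice[y yE] : forall i, exists b, nu b = coords x 0 i.
  move=> i; apply: nuE; rewrite !mem_cat; apply/orP; right; apply/orP; right.
  by apply/orP; right; apply: map_f; rewrite mem_enum.
have yxE : nu \o y = coords x 0 by apply/funext => i; exact: yE.
have /choice[z zE] : forall i, exists w, nu w = meval (coords x 0) (f i) /\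
    forall a : N -> R, absolute_value a ->
      a w <= (size (msupp (f i)))%:R * (max_abs a c * max_abs a y ^+ d) /\
      (nonarchimedean a -> a w <= max_abs a c * max_abs a y ^+ d).
  move=> i; have [w wE wB] := form_bound R cE (f_homog i)
    (mem_coefficients (p := f) (i := i)) y.
  by exists w; rewrite wE yxE.
rewrite (sxE N nu _ y yE); last by apply: sub => u us; rewrite !mem_cat us orbT.
rewrite /ratmap (syE N nu _ z); first last.
- by move=> i; rewrite (zE i).1 mxE.
- by apply: sub => u us; rewrite !mem_cat us !orbT.
rewrite mulr_natl addrC -addrA -cH [ln _ + _]addrC addrA.
have [j yj] : exists j, y j != 0.
  by have [j xj] := coords_neq0 x; exists j; rewrite -(fmorph_eq0 nu) yE.
have [j' zj] : exists j', z j' != 0.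
  have /rV0Pn[j' xj] := ratmap_coords_neq0 hx; exists j'.
  by rewrite -(fmorph_eq0 nu) (zE j').1; rewrite mxE in xj.
have c0 : c ord0 != 0 by rewrite -(fmorph_eq0 nu) cE /= oner_neq0.
have L0 : 0 < L%:R :> R by rewrite ltr0n.
rewrite -[height_in Cp z]mulr1n.
apply: height_in_le => [a aP na|a aP];
  have cM := max_abs_gt0 aP c0; have yM := max_abs_gt0 aP yj;
  have zM := max_abs_gt0 aP zj; rewrite mulr1n -lnXn //.
  rewrite -lnM ?posrE ?exprn_gt0 // ler_ln ?posrE ?mulr_gt0 ?exprn_gt0 //.
  apply: max_abs_le => [|i]; first by rewrite mulr_ge0 ?exprn_ge0 ?max_abs_ge0.
  by have [_ /(_ a aP)[_ /(_ na)]] := zE i.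
rewrite -!lnM ?posrE ?mulr_gt0 ?exprn_gt0 // ler_ln ?posrE ?mulr_gt0 ?exprn_gt0 //.
apply: max_abs_le => [|i]; first by rewrite !mulr_ge0 ?exprn_ge0 ?max_abs_ge0 // ltW.
have [_ /(_ a aP)[+ _]] := zE i => /le_trans; apply.
rewrite mulrC ler_wpM2l ?mulr_ge0 ?exprn_ge0 ?max_abs_ge0 // ler_nat.
exact: msupp_size_le.
Qed.

Lemma height_ratmap_ge (X : set (proj_space algC k)) (X_closed : closed_subvariety X)
    (XZ : forall x, X x -> ~ indeterminacy f x) :
  exists cX : R, forall (x : proj_space algC k) (hx : X x),
    height Cp (ratmap (XZ x hx)) >= d%:R * height Cp x - cX.
Proof.
have [S [S_homog XE]] := X_closed.
have [|e [G [G_homog GE]]] := projective_nullstellensatz f_homog S_homog.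
  (* A nonzero common zero of [S] and the [f i] would define a point of X in the indeterminacy
     locus. *)
  move=> v vS vf j; apply/eqP/negP => /negP vj.
  have v0 : \row_i v i != 0 by apply/rV0Pn; exists j; rewrite mxE.
  have [c c0 cE] := coords_proj_point v0.
  have scale g e : homogeneous e g -> meval v g = 0 ->
      vanishes_at g (proj_point v0).
    move=> gh gv; rewrite /vanishes_at.
    rewrite (meval_eq (v2 := fun i => c * v i)); last by move=> i; rewrite cE !mxE.
    by rewrite (meval_homogeneous _ _ gh) gv mulr0.
  apply: (XZ (proj_point v0)); first last.
    by move=> _ [i _ <-]; exact: (scale _ _ (f_homog i)).
  by rewrite XE => g Sg; have [e /scale] := S_homog g Sg; apply; exact: vS.
pose P (ji : 'I_k.+1 * 'I_m.+1) := G ji.1 ji.2.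
have [H [s0 s0E]] := height_in_const Cp (coefficients P).
(* The factor m+1 counts the terms G_ji f_i of the relation. *)
pose L := ((\sum_i size (msupp (P i))).+1 * m.+1)%N.
exists (H + ln L%:R) => x hx.
have [sx sxE] := height_coords Cp x.
have [sy syE] := height_proj_point Cp (ratmap_coords_neq0 (XZ x hx)).
pose sz := [seq coords x 0 i | i <- enum 'I_k.+1]
  ++ [seq meval (coords x 0) (f i) | i <- enum 'I_m.+1].
have [N [nu nuE]] := galois_field_exists (s0 ++ sx ++ sy ++ sz).
have sub t : {subset t <= s0 ++ sx ++ sy ++ sz} ->
    {in t, forall c, exists b, nu b = c} by move=> tsub c /tsub; exact: nuE.
have subz : {in sz, forall c, exists b, nu b = c}.
  by apply: sub => u us; rewrite 3!mem_cat us !orbT.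
have [|c cE cH] := s0E N nu; first by apply: sub => z; rewrite !mem_cat => ->.
have /choice[y yE] : forall i, exists b, nu b = coords x 0 i.
  by move=> i; apply: subz; rewrite mem_cat map_f ?mem_enum.
have /choice[z zE] : forall i, exists b, nu b = meval (coords x 0) (f i).
  move=> i; apply: subz; rewrite mem_cat; apply/orP; right.
  by apply: (map_f (fun i => meval (coords x 0) (f i))); rewrite mem_enum.
have yxE : nu \o y = coords x 0 by apply/funext => i; exact: yE.
have /choice[w wE] : forall ji, exists w, nu w = meval (coords x 0) (P ji) /\
    forall a : N -> R, absolute_value a ->
      a w <= (size (msupp (P ji)))%:R * (max_abs a c * max_abs a y ^+ e) /\
      (nonarchimedean a -> a w <= max_abs a c * max_abs a y ^+ e).
  move=> ji; have [w wE wB] := form_bound R cE (G_homog ji.1 ji.2)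
    (mem_coefficients (p := P) (i := ji)) y.
  by exists w; rewrite wE yxE.
have relation j : y j ^+ (e + d) = \sum_i w (j, i) * z i.
  apply: (fmorph_inj nu); rewrite rmorphXn /= yE GE; last by move: (hx); rewrite XE.
  rewrite rmorph_sum; apply: eq_bigr => i _.
  by rewrite rmorphM (wE (j, i)).1 zE.
rewrite (sxE N nu _ y yE); last by apply: sub => u us; rewrite !mem_cat us orbT.
rewrite /ratmap (syE N nu _ z); first last.
- by move=> i; rewrite zE mxE.
- by apply: sub => u us; rewrite !mem_cat us !orbT.
rewrite mulr_natl lerBlDr addrC -cH addrAC.
have [j yj] : exists j, y j != 0.
  by have [j xj] := coords_neq0 x; exists j; rewrite -(fmorph_eq0 nu) yE.
have [j' zj] : exists j', z j' != 0.
  have /rV0Pn[j' xj] := ratmap_coords_neq0 (XZ x hx); exists j'.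
  by rewrite -(fmorph_eq0 nu) zE; rewrite mxE in xj.
have c0 : c ord0 != 0 by rewrite -(fmorph_eq0 nu) cE /= oner_neq0.
have L0 : 0 < L%:R :> R by rewrite ltr0n.
rewrite -[height_in Cp z]mulr1n.
apply: height_in_le => [a aP na|a aP];
  have cM := max_abs_gt0 aP c0; have yM := max_abs_gt0 aP yj;
  have zM := max_abs_gt0 aP zj; rewrite mulr1n -lnXn //;
  rewrite -!lnM ?posrE ?mulr_gt0 ?exprn_gt0 // ler_ln ?posrE ?mulr_gt0 ?exprn_gt0 //;
  (* After multiplication by |y|^e, the left side is |y_i|^(e+d) for an index [i] where the maximum
     is attained, and [relation] expresses y_i^(e+d) through the values [z]. *)
  have [i iE] := max_abs_attained yM;
  rewrite -(ler_pM2l (exprn_gt0 e yM)) -exprD {1}iE -absvX // relation.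
  apply: nonarchimedean_sum => // [|i' _].
    by rewrite !mulr_ge0 ?exprn_ge0 ?max_abs_ge0.
  rewrite absvM // mulrA; apply: ler_pM; rewrite ?absv_ge0 ?le_max_abs //.
  by have [_ /(_ a aP)[_ /(_ na)]] := wE (i, i'); rewrite mulrC.
apply: le_trans (absv_sum aP _ _ _) _.
have le_term i' : true -> a (w (i, i') * z i') <=
    (\sum_i size (msupp (P i))).+1%:R * (max_abs a c * max_abs a y ^+ e) * max_abs a z.
  move=> _; rewrite absvM //; apply: ler_pM; rewrite ?absv_ge0 ?le_max_abs //.
  have [_ /(_ a aP)[+ _]] := wE (i, i') => /le_trans; apply.
  rewrite ler_wpM2r ?mulr_ge0 ?exprn_ge0 ?max_abs_ge0 // ler_nat.
  exact: msupp_size_le.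
apply: le_trans (ler_sum _ le_term) _.
rewrite sumr_const card_ord -mulr_natr le_eqVlt; apply/orP; left; apply/eqP.
by rewrite /L natrM; ring.
Qed.

End Estimates.

Theorem mainTheorem1 (R : realType)
    (Cp : forall p : prime_number, padic_complex R (val p))
    (k m d : nat) (f : 'I_m.+1 -> mpoly.mpoly k.+1 algC)
    (f_homogeneous : forall i, homogeneous d (f i))
    (f_coprime : no_common_factor f) :
  (exists c1 : R, forall (x : proj_space algC k) (hx : ~ indeterminacy f x),
      height Cp (ratmap hx) <= d%:R * height Cp x + c1) /\
  (forall (X : set (proj_space algC k)) (X_closed : closed_subvariety X)
      (XZ : forall x, X x -> ~ indeterminacy f x),
    exists cX : R, forall (x : proj_space algC k) (hx : X x),
      height Cp (ratmap (XZ x hx)) >= d%:R * height Cp x - cX).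
Proof.
split; first exact: height_ratmap_le.
by move=> X X_closed XZ; exact: height_ratmap_ge.
Qed.
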